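(* Let $A$ and $B$ be bounded subsets of $\mathbb{R}$ with $D_B\le D_A$, where $D_A=\mathrm{diam}(A)$, $D_B=\mathrm{diam}(B)$, and suppose $$\lambda(A+B)=D_A+\lambda(B)<\lambda(A)+2\lambda(B).$$ Put $A'=A-\inf(A)$ and $B'=B-\inf(B)$. Then there exist positive real numbers $b,c$ with $b,c\le D_B$ such that the interval $I=(b,D_B-c)$ has length at least $\lambda(A)+\lambda(B)-D_A$ and, writing $B_1=B'\cap[0,b]$ and $B_2=D_B-(B'\cap[D_B-c,D_B])$, the following hold up to sets of Lebesgue measure $0$: \begin{itemize} \item $B'\cap[0,b]=(A'+B')\cap[0,b]$; \item $(A'+B')\cap[D_A+D_B-c,\,D_A+D_B]=D_A+D_B-B_2$; \item $I\subset B'$; \item $(b,D_A+D_B-c)\subset A'+B'$; \item $B'=B_1\cup I\cup(D_B-B_2)$ and $A'+B'=B_1\cup(b,D_A+D_B-c)\cup(D_A+D_B-B_2)$. \end{itemize} Furthermore, up to sets of measure $0$, $A'$ is a disjoint union $A'=A_1\cup A_I\cup(D_A-A_2)$ of three sets such that \begin{itemize} \item $A_1\subset B_1$, $A_2\subset B_2$, $A_I\subset(b,D_A-c)$; \item $\lambda(A_1\cap[0,x])\le x^2/c_1$ for all $0<x\le c_1$, where $c_1=\sup\{x:\lambda(B'\cap[0,x])\le\tfrac12x\}$; \item $\lambda(A_2\cap[0,x])\le x^2/c_2$ for all $0<x\le c_2$, where $c_2=\sup\{x:\lambda(B'\cap(D_B-x,D_B))\le\tfrac12x\}$. \end{itemi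ze}
   Context: $\lambda$ denotes the inner Lebesgue measure on $\mathbb{R}$; for a bounded set $S\subset\mathbb{R}$, $\mathrm{diam}(S)=\sup(S)-\inf(S)$. For $t\in\mathbb{R}$ and $X\subset\mathbb{R}$, $t-X=\{t-x:x\in X\}$. The first two bulleted items are what the paper phrases as ''$B_1$ is $A'$-stable'' and ''$B_2$ is $A'$-stable'' (the latter understood after the reflection $x\mapsto D_A+D_B-x$).
   Formalization: b and c are only nonnegative (A=B=[0,1] forces b=c=0); the suprema defining c_1 and c_2 run over 0≤x≤D_B (otherwise infinite); ''up to measure 0'' means each set difference separately has inner Lebesgue measure 0 (outer-null versions fail for non-measurable sets). *)

(* Defs.v *)
From HB Require Import structures.
From mathcomp Require Import all_boot all_order all_algebra.
From mathcomp Require Import all_classical all_reals all_analysis.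

Set Implicit Arguments.
Unset Strict Implicit.
Unset Printing Implicit Defensive.

Import Order.TTheory GRing.Theory Num.Theory.
Import numFieldNormedType.Exports.

Local Open Scope classical_set_scope.
Local Open Scope ring_scope.

Definition inner_lebesgue (R : realType) (S : set R) : \bar R :=
  ereal_sup [set lebesgue_measure K | K in [set K | compact K /\ K `<=` S]].

Definition diam (R : realType) (S : set R) : R := sup S - inf S.

Definition sumset (R : realType) (X Y : set R) : set R :=
  [set x + y | x in X & y in Y].

Definition refl_set (R : realType) (t : R) (X : set R) : set R :=
  [set t - x | x in X].

Definition shift_inf (R : realType) (X : set R) : set R :=
  [set x - inf X | x in X].

(* Sums of two sets need not be measurable, so "measure 0" refers to the inner
   measure, like every other measure here. Sets of inner measure 0 are not
   closed under union; equality up to measure 0 therefore bounds the two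
   differences separately and not the symmetric difference. *)
Definition sub_upto0 (R : realType) (X Y : set R) : Prop :=
  inner_lebesgue (X `\` Y) = 0%E.

Definition eq_upto0 (R : realType) (X Y : set R) : Prop :=
  sub_upto0 X Y /\ sub_upto0 Y X.

(* Main.v *)
Require Import Defs.
From HB Require Import structures.
From mathcomp Require Import all_boot all_order all_algebra.
From mathcomp Require Import all_classical all_reals all_analysis.
From mathcomp Require Import measurable_realfun.
From mathcomp Require Import ring lra.

Set Implicit Arguments.
Unset Strict Implicit.
Unset Printing Implicit Defensive.

Import Order.TTheory GRing.Theory Num.Theory.
Import numFieldNormedType.Exports.

Local Open Scope classical_set_scope.
Local Open Scope ring_scope.

(** Shrinking to sigma-compact subsets of full inner measure and adding the
    endpoints, which by continuity of translations changes [A + B] by a null set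
    only, one may assume that all sets are measurable and that
    [0, D_A \in A' <= [0, D_A]] and [0, D_B \in B' <= [0, D_B]].

    Let [f x = |A' n [0, x]| + |B' n [0, x]| - x], so that [f 0 = 0] and
    [f D_A = delta = |A| + |B| - D_A > 0].  By the pigeonhole principle
    [f x > 0] puts [x] in [A' + B'], and [f x < delta] puts [x + D_A] there.
    Hence every class modulo [D_A] meets [A' + B'], and the classes of points of
    [B'] meet it twice; as [|A + B| = D_A + |B|], almost no other class does.
    Thus [0 < f < delta] forces [x \in B'] almost everywhere, where [f] is then
    nondecreasing: [f] is [<= 0] up to a point [b] and positive afterwards, and
    grows from [0] to [delta] inside [B'].  The same applied to the reflected
    sets gives [c].

    For [x \in A'], the part of [B'] below [b] is stable under [A'], so by
    Raikov's inequality on the circle [R / x Z] its successive layers of width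
    [x] grow by at least [|A' n [0, x]|].  If that exceeded [x^2 / c_1], summing
    the layers would give [|B' n [0, c_1]| > c_1 / 2]. *)

(** * Lebesgue measure on sets of finite measure *)

Section finite_measure_sets.
Variable R : realType.
Implicit Types X Y Z : set R.
Local Notation mu := (@lebesgue_measure R).

(** Real-valued, so that linear arithmetic applies. Infinite measure is sent to 0, hence the
    condition [fm] carried along with it. *)
Definition leb X : R := fine (mu X).
Definition fm X : Prop := measurable X /\ (mu X < +oo)%E.

Lemma fm_measurable X : fm X -> measurable X. Proof. by case. Qed.

Lemma lebE X : fm X -> mu X = (leb X)%:E.
Proof. by move=> [mX fX]; rewrite /leb fineK// ge0_fin_numE. Qed.

Lemma fmS X Y : measurable X -> fm Y -> X `<=` Y -> fm X.
Proof.
move=> mX [mY fY] XY; split => //; apply: le_lt_trans fY.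
by apply: le_measure; rewrite ?inE.
Qed.

Lemma fmI X Y : fm X -> measurable Y -> fm (X `&` Y).
Proof.
move=> fX mY; apply: (fmS _ fX); last exact: subIsetl.
by apply: measurableI => //; case: fX.
Qed.

Lemma fmIr X Y : measurable X -> fm Y -> fm (X `&` Y).
Proof. by move=> mX fY; rewrite setIC; apply: fmI. Qed.

Lemma fmD X Y : fm X -> measurable Y -> fm (X `\` Y).
Proof.
move=> fX mY; apply: (fmS _ fX); last exact: subDsetl.
by apply: measurableD => //; case: fX.
Qed.

Lemma fmU X Y : fm X -> fm Y -> fm (X `|` Y).
Proof.
move=> [mX fX] [mY fY]; split; first exact: measurableU.
apply: le_lt_trans (measureU2 _ _ _) _ => //.
exact: lte_add_pinfty.
Qed.

Lemma fm_itv (x y : bool) (a b : R) :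
  fm [set` Interval (BSide x a) (BSide y b)].
Proof.
split; first exact: measurable_itv.
rewrite lebesgue_measure_itv /=; case: ifP => _; last exact: ltry.
by rewrite -EFinB ltry.
Qed.

Lemma fm_bounded X (a b : R) : measurable X -> X `<=` `[a, b] -> fm X.
Proof. by move=> mX; apply: fmS => //; apply: fm_itv. Qed.

Lemma leb_ge0 X : 0 <= leb X.
Proof. by apply: fine_ge0; apply: measure_ge0. Qed.

Lemma leb0 : leb set0 = 0.
Proof. by rewrite /leb measure0. Qed.

Lemma le_leb X Y : measurable X -> fm Y -> X `<=` Y -> leb X <= leb Y.
Proof.
move=> mX fY XY; rewrite -lee_fin -!lebE//; last exact: fmS fY XY.
by apply: le_measure; rewrite ?inE//; case: fY.
Qed.

Lemma lebU X Y : fm X -> fm Y -> X `&` Y = set0 ->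
  leb (X `|` Y) = leb X + leb Y.
Proof.
move=> fX fY XY; apply: EFin_inj; rewrite EFinD -!lebE//; last exact: fmU.
by apply: measureU => //; apply: fm_measurable.
Qed.

Lemma lebID X Y : fm X -> measurable Y -> leb X = leb (X `&` Y) + leb (X `\` Y).
Proof.
move=> fX mY; rewrite -lebU ?setUIDK//; [exact: fmI|exact: fmD|].
by rewrite setDE setIACA setICr setI0.
Qed.

Lemma lebUI X Y : fm X -> fm Y -> leb (X `|` Y) + leb (X `&` Y) = leb X + leb Y.
Proof.
move=> fX fY; have [mX mY] := (fm_measurable fX, fm_measurable fY).
rewrite (lebID (fmU fX fY) mX) setIUl setIid (setUidl (@subIsetr _ Y X)).
have -> : (X `|` Y) `\` X = Y `\` X by rewrite setDUl setDv set0U.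
by rewrite (lebID fY mX) (setIC Y); ring.
Qed.

Lemma leb_gt0_ex X : 0 < leb X -> exists x, X x.
Proof.
move=> X0; apply/set0P/negP => /eqP XE.
by move: X0; rewrite XE leb0 ltxx.
Qed.

Lemma leb_le_ae X Y : fm X -> fm Y -> leb (X `\` Y) = 0 -> leb X <= leb Y.
Proof.
move=> fX fY XY; rewrite (lebID fX (fm_measurable fY)) XY addr0.
apply: le_leb => //; first by apply: fm_measurable; apply: fmI => //; case: fY.
Qed.

Lemma leb_null X Y : measurable X -> fm Y -> X `<=` Y -> leb Y = 0 -> leb X = 0.
Proof.
move=> mX fY XY Y0; apply/eqP; rewrite eq_le leb_ge0 andbT -Y0.
exact: le_leb.
Qed.

Lemma leb_itv (x y : bool) (a b : R) : a <= b ->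
  leb [set` Interval (BSide x a) (BSide y b)] = b - a.
Proof.
rewrite /leb lebesgue_measure_itv /= lte_fin.
by case: ltP => // ba ab; rewrite (@le_anti _ _ a b) ?subrr// ab ba.
Qed.

Lemma leb_set1 (a : R) : leb [set a] = 0.
Proof. by rewrite /leb lebesgue_measure_set1. Qed.

Lemma fm_set1 (a : R) : fm [set a].
Proof. by rewrite -set_itv1; apply: fm_itv. Qed.

(** * Translations and reflections *)

Lemma measurable_preim_affine (s e : R) X : measurable X ->
  measurable [set t | X (s * t + e)].
Proof.
move=> mX; rewrite -[X in measurable X]setTI.
apply: (@measurable_funTS _ _ _ _ _ (fun t : R => s * t + e)) => //.
apply: measurable_funD => //; apply: measurable_funM => //.
Qed.

(** The image of the measure under a translation agrees with it on half-open intervals, hence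
    everywhere by uniqueness. *)
Lemma mu_translate (e : R) X : measurable X -> mu [set t | X (t + e)] = mu X.
Proof.
pose f := (fun t => t + e) : measurableTypeR R -> measurableTypeR R.
have mf : measurable_fun setT f by apply: measurable_funD.
move=> mX; change (pushforward mu f X = mu X).
apply/esym/lebesgue_measure_unique => //= _ [[a b]] _ <-.
rewrite /pushforward /=.
have -> : f @^-1` `]a, b] = `]a - e, b - e]%classic.
  by apply/seteqP; split=> t /=; rewrite /f !in_itv/= => /andP[]; lra.
rewrite !lebesgue_measure_itv /= !lte_fin ltrD2r; case: ifP => // _.
by rewrite -!EFinB; congr EFin; ring.
Qed.

Lemma measurable_translate (e : R) X :
  measurable X -> measurable [set t | X (t + e)].
Proof.
move=> mX; have := measurable_preim_affine 1 e mX.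
by under eq_set do rewrite mul1r.
Qed.

Lemma fm_translate (e : R) X : fm X -> fm [set t | X (t + e)].
Proof.
by move=> [mX fX]; split; [exact: measurable_translate|rewrite mu_translate].
Qed.

Lemma leb_translate (e : R) X : measurable X -> leb [set t | X (t + e)] = leb X.
Proof. by move=> mX; rewrite /leb mu_translate. Qed.

Lemma mu_reflect (e : R) X : measurable X -> mu [set t | X (e - t)] = mu X.
Proof.
move=> mX; rewrite -[RHS](mu_translate e)// -[RHS]lebesgue_measureN.
  by congr mu; apply/seteqP; split=> t /=; rewrite addrC.
by have := measurable_preim_affine 1 e mX; under eq_set do rewrite mul1r.
Qed.

Lemma measurable_reflect (e : R) X :
  measurable X -> measurable [set t | X (e - t)].
Proof.
move=> mX; have := measurable_preim_affine (-1) e mX.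
by under eq_set do rewrite mulN1r addrC.
Qed.

Lemma fm_reflect (e : R) X : fm X -> fm [set t | X (e - t)].
Proof.
by move=> [mX fX]; split; [exact: measurable_reflect|rewrite mu_reflect].
Qed.

Lemma leb_reflect (e : R) X : measurable X -> leb [set t | X (e - t)] = leb X.
Proof. by move=> mX; rewrite /leb mu_reflect. Qed.

(** Take [K] compact in [X] and [U] open around [K], each within [eps / 2] in measure. For small [t]
    the set [K - t] stays in [U], so what [X] loses lies in [X \ K] or in [U \ (K - t)]. *)
Lemma leb_translation_cts X (eps : R) : fm X -> 0 < eps ->
  exists2 eta : R, 0 < eta &
    forall t, `|t| < eta -> leb (X `\` [set u | X (u + t)]) < eps.
Proof.
move=> fX eps0; have [mX lX] := fX.
have e2 : 0 < eps / 2 by rewrite divr_gt0.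
have [K [cK KX]] := lebesgue_regularity_inner mX lX e2.
have mK := compact_measurable cK; have fK := fmS mK fX KX.
rewrite -[X in (X < _)%E]/(mu _) lebE ?lte_fin; last exact: fmD.
move=> XK; have [mK' lK] := fK.
have [U [oU KU]] := lebesgue_regularity_outer mK lK e2.
have mU := open_measurable oU.
move=> UK0; have fUK : fm (U `\` K).
  split; first exact: measurableD.
  by apply: lt_trans UK0 _; apply: ltry.
have fU : fm U by rewrite -(setDUK KU); apply: fmU.
move: UK0; rewrite -[X in (X < _)%E]/(mu _) lebE// lte_fin => UK.
(* Compactness of [K] makes one [eta] work for all of its points. *)
have := (compact_near_coveringP K).1 cK _ (nbhs (0 : R)) (fun t u => U (u - t)) _.
case.
  move=> u Ku; have : nbhs (u - 0) U.
    by rewrite subr0; apply: open_nbhs_nbhs; split => //; apply: KU.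
  by move=> nU; exact: (@sub_continuous R (u, 0) U nU).
move=> eta /= eta0 He; exists eta => // t te.
have KtU : [set u | K (u + t)] `<=` U.
  move=> u /= Kut; have := He t; rewrite /ball_ /= sub0r normrN => /(_ te _ Kut).
  by rewrite addrK.
have fKt := fm_translate t fK.
have sub : X `\` [set u | X (u + t)] `<=` (X `\` K) `|` (U `\` [set u | K (u + t)]).
  move=> u [Xu nXu]; have [Ku|nKu] := pselect (K u); last by left.
  by right; split; [apply: KU|move=> /KX].
have mKt := fm_measurable fKt.
apply: le_lt_trans (le_leb _ _ sub) _.
- by apply: measurableD => //; apply: fm_measurable; apply: fm_translate.
- by apply: fmU; apply: fmD.
have := lebUI (fmD fX mK) (fmD fU mKt).
have := lebID fU mK; rewrite (setIidr KU).
have := lebID fU mKt; rewrite (setIidr KtU) leb_translate//.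
have := leb_ge0 ((X `\` K) `&` (U `\` [set u | K (u + t)])).
by move: XK UK; lra.
Qed.

End finite_measure_sets.

(** * Sumsets modulo [x] *)

Section circle_sumsets.
Variable R : realType.
Implicit Types V W X Y : set R.
Local Notation mu := (@lebesgue_measure R).

(** For [Y] in [0, x[ the two alternatives say that [t - e] lies in [Y] modulo [x]: this is [Y]
    rotated by [e], cut where it wraps around. *)
Lemma rot_decomp (x e : R) Y : Y `<=` `[0, x[ -> 0 <= e <= x ->
  `[0, x[ `&` [set t | Y (t - e) \/ Y (t - e + x)] =
  [set t | (Y `&` `[0, x - e[) (t - e)] `|`
  [set t | (Y `&` `[x - e, x[) (t + (x - e))].
Proof.
move=> Yx /andP[e0 ex]; apply/seteqP; split => t /=; rewrite !in_itv/=.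
  move=> [/andP[t0 tx] [Yt|Yt]]; have := Yx _ Yt; rewrite /= in_itv/= => /andP[? ?].
    by left; split => //; lra.
  by right; rewrite addrCA addrC; split => //; lra.
by move=> [[Yt /andP[? ?]]|[Yt /andP[? ?]]]; split; try lra;
  [left|right; rewrite -addrA (addrC (- e))].
Qed.

Lemma fm_rot (x e : R) Y : measurable Y ->
  fm (`[0, x[ `&` [set t | Y (t - e) \/ Y (t - e + x)]).
Proof.
move=> mY; apply: fmI; first exact: fm_itv.
have -> : [set t | Y (t - e) \/ Y (t - e + x)] =
  [set t | Y (t - e)] `|` [set t | Y (t + (x - e))].
  by apply/seteqP; split => t /=; rewrite addrA addrAC.
by apply: measurableU; apply: measurable_translate.
Qed.

Lemma leb_rot (x e : R) Y : measurable Y -> Y `<=` `[0, x[ -> 0 <= e <= x ->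
  leb (`[0, x[ `&` [set t | Y (t - e) \/ Y (t - e + x)]) = leb Y.
Proof.
move=> mY Yx ex0; have /andP[e0 ex] := ex0; rewrite rot_decomp//.
have fY := fmS mY (fm_itv true true 0 x) Yx.
have f1 : fm (Y `&` `[0, x - e[) by apply: fmI.
have f2 : fm (Y `&` `[x - e, x[) by apply: fmI.
rewrite lebU; first last.
- apply/seteqP; split => t //=; rewrite !in_itv/= => -[[_ /andP[? ?]] [_ /andP[? ?]]].
  by lra.
- exact: (fm_translate (x - e) f2).
- exact: (fm_translate (- e) f1).
rewrite (leb_translate (- e) (fm_measurable f1)).
rewrite (leb_translate (x - e) (fm_measurable f2)).
rewrite -lebU//; last first.
  apply/seteqP; split => t //=; rewrite !in_itv/= => -[[_ /andP[? ?]] [_ /andP[? ?]]].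
  by lra.
congr leb; apply/seteqP; split => t /=; first by move=> [[]|[]].
move=> Yt; have := Yx _ Yt; rewrite /= !in_itv/= => /andP[? ?].
by have [?|?] := ltP t (x - e); [left|right]; split => //; lra.
Qed.

(** Moving [e] to [e'] changes the value by at most what [X] loses under a translation of length
    [|e' - e|]. *)
Lemma correlation_cts V X : fm V -> fm X ->
  continuous (fun e : R => leb (V `&` [set t | X (t + e)])).
Proof.
move=> fV fX.
have key (e e' : R) : leb (V `&` [set t | X (t + e)]) <=
    leb (V `&` [set t | X (t + e')]) + leb (X `\` [set u | X (u + (e' - e))]).
  have mX := fm_measurable fX.
  have mXt a : measurable [set t | X (t + a)] by apply: measurable_translate.
  set D := X `\` _; have fD : fm D by apply: fmD.
  rewrite -(leb_translate e (fm_measurable fD)).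
  set Y1 := V `&` [set t | X (t + e')]; set Y2 := [set t | D (t + e)].
  have f1 : fm Y1 by apply: fmI.
  have f2 : fm Y2 by apply: (fm_translate e).
  have := lebUI f1 f2; have := leb_ge0 (Y1 `&` Y2).
  suff : leb (V `&` [set t | X (t + e)]) <= leb (Y1 `|` Y2) by lra.
  apply: le_leb; [by apply: fm_measurable; apply: fmI|exact: fmU|].
  move=> t [Vt Xt]; have [Xt'|nXt'] := pselect (X (t + e')); first by left.
  by right; split => //=; have -> : t + e + (e' - e) = t + e' by ring.
move=> e; apply/cvgrPdist_lt => eps eps0.
have [eta eta0 He] := leb_translation_cts fX eps0.
near=> e'.
have ee : `|e' - e| < eta.
  by rewrite distrC; near: e'; exact: cvgr_dist_lt.
have := key e e'; have := key e' e.
have := He _ ee; rewrite distrC in ee; have := He _ ee.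
by move=> ? ? ? ?; rewrite ltr_norml; apply/andP; split; lra.
Unshelve. all: by end_near. Qed.

(** Dyson's transform on R / x Z, realised on [0, x[: [dyson_cap] is the intersection of [V] with
    [X - e], and [dyson_cup] the union of [X] with [V + e], both modulo [x]. *)
Definition dyson_cap (x e : R) V X :=
  V `&` [set t | X (t + e) \/ X (t + (e - x))].

Definition dyson_cup (x e : R) V X :=
  X `|` (`[0, x[ `&` [set t | V (t - e) \/ V (t - e + x)]).

Lemma fm_dyson_cap (x e : R) V X : fm V -> fm X -> fm (dyson_cap x e V X).
Proof.
move=> fV fX; apply: fmI => //.
by apply: measurableU; apply: measurable_translate; apply: fm_measurable.
Qed.

Lemma leb_dyson_cap (x e : R) V X : 0 < x -> fm V -> fm X -> X `<=` `[0, x[ ->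
  leb (dyson_cap x e V X) =
  leb (V `&` [set t | X (t + e)]) + leb (V `&` [set t | X (t + (e - x))]).
Proof.
move=> x0 fV fX Xx; rewrite -lebU.
- by rewrite -setIUr.
- by apply: fmI => //; apply: measurable_translate; apply: fm_measurable.
- by apply: fmI => //; apply: measurable_translate; apply: fm_measurable.
apply/seteqP; split => // t /= [[_ X1] [_ X2]].
by have := Xx _ X1; have := Xx _ X2; rewrite /= !in_itv/= => /andP[? ?] /andP[? ?]; lra.
Qed.

Lemma dyson_cap_cts (x : R) V X : 0 < x -> fm V -> fm X -> X `<=` `[0, x[ ->
  continuous (fun e : R => leb (dyson_cap x e V X)).
Proof.
move=> x0 fV fX Xx.
have -> : (fun e : R => leb (dyson_cap x e V X)) =
  (fun e => leb (V `&` [set t | X (t + e)])) \+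
  ((fun e => leb (V `&` [set t | X (t + e)])) \o (fun e => e - x)).
  by apply/funext => e; apply: leb_dyson_cap.
move=> e; apply: cvgD; first exact: correlation_cts.
apply: continuous_comp; last exact: correlation_cts.
by apply: cvgB; [exact: cvg_id|exact: cvg_cst].
Qed.

(** Rotating by [e] turns [dyson_cap] into the intersection of [X] with [V + e], while [dyson_cup]
    is their union; inclusion-exclusion concludes. *)
Lemma leb_dyson (x e : R) V X : 0 <= e <= x ->
    measurable V -> measurable X -> V `<=` `[0, x[ -> X `<=` `[0, x[ ->
  leb (dyson_cap x e V X) + leb (dyson_cup x e V X) = leb V + leb X.
Proof.
move=> ex mV mX Vx Xx.
have fV := fmS mV (fm_itv true true 0 x) Vx.
have fX := fmS mX (fm_itv true true 0 x) Xx.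
have mC := fm_measurable (fm_dyson_cap x e fV fX).
have Cx : dyson_cap x e V X `<=` `[0, x[ by move=> t [/Vx].
rewrite -(leb_rot mC Cx ex) -(leb_rot mV Vx ex) addrC [RHS]addrC -[RHS]lebUI//; last first.
  exact: fm_rot.
congr (_ + leb _); apply/seteqP; split => t; rewrite /dyson_cap /= !in_itv/=.
  move=> [/andP[? ?] h].
  have nX1 : ~ X (t - e + (e - x)).
    by move=> /Xx; rewrite /= in_itv/=; lra.
  have nX2 : ~ X (t - e + x + e).
    by move=> /Xx; rewrite /= in_itv/= => /andP[? ?]; lra.
  move: h nX1 nX2; rewrite subrK.
  have -> : t - e + x + (e - x) = t by ring.
  move=> [[? [?|?]]|[? [?|?]]] nX1 nX2 //; split => //; split => //; try lra.
    by left. by right.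
move=> [Xt [tx h]]; split => //; rewrite subrK.
have -> : t - e + x + (e - x) = t by ring.
by case: h => h; [left|right]; split => //; [left|right].
Qed.

(** A new point of [dyson_cup] is [v' + e] with [v'] in [V]; adding [v] from [dyson_cap] gives
    [v' + (v + e)], where [v + e] is in [X] modulo [x]. *)
Lemma dyson_sub (x e : R) V X W : V `<=` `[0, x[ -> X `<=` `[0, x[ -> W `<=` `[0, x[ ->
    (forall v u, V v -> X u -> W (v + u) \/ W (v + u - x)) ->
  forall v u, dyson_cap x e V X v -> dyson_cup x e V X u ->
    W (v + u) \/ W (v + u - x).
Proof.
move=> Vx Xx Wx H v u [Vv Xv] [Xu|[/= ux hu]]; first exact: H.
have := Vx _ Vv; move: ux; rewrite /= !in_itv/= => /andP[u0 ux] /andP[v0 vx].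
have nW z : W z -> 0 <= z < x by move=> /Wx; rewrite /= in_itv.
move: Xv => /= -[Xv|Xv]; case: hu => Vu; have := H _ _ Vu Xv.
- by have -> : u - e + (v + e) = v + u by ring.
- have -> : u - e + x + (v + e) = v + u + x by ring.
  by rewrite addrK => -[/nW /andP[? ?]|?]; [lra|left].
- have -> : u - e + (v + (e - x)) = v + u - x by ring.
  by move=> [?|/nW /andP[? ?]]; [right|lra].
- by have -> : u - e + x + (v + (e - x)) = v + u by ring.
Qed.

(** Fubini on the pairs (e, t) with [t] in [V] and [t + e] in [X] modulo [x]: each section at fixed
    [t] has the measure of [X]. *)
Lemma dyson_average (x : R) V X :
    measurable V -> measurable X -> V `<=` `[0, x[ -> X `<=` `[0, x[ ->
  (\int[mu]_(e in `[0%R, x[) (leb (dyson_cap x e V X))%:E = (leb V * leb X)%R%:E)%E.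
Proof.
move=> mV mX Vx Xx.
have fV := fmS mV (fm_itv true true 0 x) Vx.
have fX := fmS mX (fm_itv true true 0 x) Xx.
pose mR := measurableTypeR R.
pose P : set (mR * mR) := [set p | 0 <= p.1 < x /\ dyson_cap x p.1 V X p.2].
have mP : measurable P.
  have -> : P = (`[0, x[%classic `*` V) `&` (((fun p => p.2 + p.1) @^-1` X) `|`
      ((fun p => p.2 + (p.1 - x)) @^-1` X)).
    by apply/seteqP; split => -[e t] /=; rewrite in_itv /=; [move=> [? []]|move=> [[]]].
  apply: measurableI; first exact: measurableX.
  have m1 : measurable_fun setT (@fst mR mR) by exact: measurable_fst.
  have m2 : measurable_fun setT (@snd mR mR) by exact: measurable_snd.
  apply: measurableU; rewrite -[X in measurable X]setTI.
    by apply: (measurable_funD m2 m1).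
  have m3 : measurable_fun setT ((@fst mR mR) \- cst x).
    by apply: measurable_funB.
  by apply: (measurable_funD m2 m3).
have := @indic_fubini_tonelli _ _ mR mR R mu mu P mP.
rewrite indic_fubini_tonelli_FE// indic_fubini_tonelli_GE// => FG.
rewrite integral_mkcond.
transitivity (\int[mu]_e (mu \o xsection P) e)%E.
  apply: eq_integral => e _; rewrite patchE /=.
  case: ifPn => [|/negP]; rewrite inE/= in_itv/= => ex.
    rewrite -lebE; last exact: fm_dyson_cap.
    congr (mu _); apply/seteqP; split => t; rewrite /xsection /= inE; first by [].
    by move=> [].
  rewrite (_ : xsection _ _ = set0) ?measure0//.
  by apply/seteqP; split => t //; rewrite /xsection /= inE => -[].
rewrite FG; transitivity (\int[mu]_(t in V) (leb X)%:E)%E; last first.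
  rewrite integral_cst// muleC; rewrite -[X in (X * _)%E]/(mu V) lebE//.
rewrite [RHS]integral_mkcond; apply: eq_integral => t _; rewrite patchE /=.
case: ifPn => [|/negP]; rewrite inE/= => Vt.
  have := Vx _ Vt; rewrite /= in_itv/= => /andP[t0 tx].
  (* The section at [t] is [X - t], that is, [X] rotated by [x - t]. *)
  have xt : 0 <= x - t <= x by lra.
  have fr := fm_rot x (x - t) mX.
  rewrite -(leb_rot mX Xx xt) -lebE//.
  congr (mu _); apply/seteqP; split => e; rewrite /ysection /dyson_cap /= inE in_itv/=.
    move=> [? [_ /= h]]; split => //; rewrite orC.
    have -> : e - (x - t) = t + (e - x) by ring.
    by have -> : t + (e - x) + x = t + e by ring.
  move=> [? h]; split => //; split => //=; move: h; rewrite orC.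
  have -> : e - (x - t) = t + (e - x) by ring.
  by have -> : t + (e - x) + x = t + e by ring.
rewrite (_ : ysection _ _ = set0) ?measure0//.
by apply/seteqP; split => e //; rewrite /ysection /= inE => -[_ []].
Qed.

Lemma measurable_dyson_cap_leb (x : R) V X : 0 < x -> fm V -> fm X -> X `<=` `[0, x[ ->
  measurable_fun setT (fun e => (leb (dyson_cap x e V X))%:E).
Proof.
move=> x0 fV fX Xx; apply/measurable_EFinP.
by apply: continuous_measurable_fun; apply: dyson_cap_cts.
Qed.

Lemma dyson_average_le (x c : R) V X : 0 < x ->
    measurable V -> measurable X -> V `<=` `[0, x[ -> X `<=` `[0, x[ ->
    (forall e, 0 <= e < x -> c <= leb (dyson_cap x e V X)) -> 0 <= c ->
  c * x <= leb V * leb X.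
Proof.
move=> x0 mV mX Vx Xx H c0.
have fV := fmS mV (fm_itv true true 0 x) Vx.
have fX := fmS mX (fm_itv true true 0 x) Xx.
rewrite -lee_fin -(@dyson_average x)// EFinM.
rewrite -[x in (_ * x%:E)%E]subr0 -(@leb_itv _ true true)//; last exact: ltW.
rewrite -lebE; last exact: fm_itv.
rewrite -integral_cst//; apply: ge0_le_integral => //.
- by apply: measurable_funTS; exact: measurable_dyson_cap_leb.
Qed.

Lemma dyson_average_ge (x c : R) V X : 0 < x ->
    measurable V -> measurable X -> V `<=` `[0, x[ -> X `<=` `[0, x[ ->
    (forall e, 0 <= e < x -> leb (dyson_cap x e V X) <= c) -> 0 <= c ->
  leb V * leb X <= c * x.
Proof.
move=> x0 mV mX Vx Xx H c0.
have fV := fmS mV (fm_itv true true 0 x) Vx.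
have fX := fmS mX (fm_itv true true 0 x) Xx.
rewrite -lee_fin -(@dyson_average x)// EFinM.
rewrite -[x in (_ * x%:E)%E]subr0 -(@leb_itv _ true true)//; last exact: ltW.
rewrite -lebE; last exact: fm_itv.
rewrite -integral_cst//; apply: ge0_le_integral => //.
- by move=> e _; rewrite lee_fin leb_ge0.
- by apply: measurable_funTS; exact: measurable_dyson_cap_leb.
Qed.

(** The average lies strictly between 0 and [c], so some [e0] gives a value below [c] and some [e1]
    a positive one. If neither serves, the intermediate value theorem yields the value [c]. *)
Lemma dyson_small (x c : R) V X : 0 < x ->
    measurable V -> measurable X -> V `<=` `[0, x[ -> X `<=` `[0, x[ ->
    0 < leb V -> 0 < leb X -> 0 < c -> leb V * leb X < c * x ->
  exists2 e, 0 <= e < x & 0 < leb (dyson_cap x e V X) <= c.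
Proof.
move=> x0 mV mX Vx Xx V0 X0 c0 VXc.
have fV := fmS mV (fm_itv true true 0 x) Vx.
have fX := fmS mX (fm_itv true true 0 x) Xx.
have [e0 e0x he0] : exists2 e, 0 <= e < x & leb (dyson_cap x e V X) < c.
  apply: contrapT => h; suff : c * x <= leb V * leb X by rewrite leNgt VXc.
  apply: dyson_average_le => // [e ex|]; last exact: ltW.
  by rewrite leNgt; apply/negP => ?; apply: h; exists e.
have [e1 e1x he1] : exists2 e, 0 <= e < x & 0 < leb (dyson_cap x e V X).
  apply: contrapT => h; suff : leb V * leb X <= 0 * x.
    by rewrite mul0r leNgt mulr_gt0.
  apply: dyson_average_ge => // e ex.
  by rewrite leNgt; apply/negP => ?; apply: h; exists e.
have [h0|] := ltP 0 (leb (dyson_cap x e0 V X)); first by exists e0; rewrite // h0 ltW.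
move=> h0; have [h1|h1] := leP (leb (dyson_cap x e1 V X)) c.
  by exists e1; rewrite // he1.
have cts := dyson_cap_cts x0 fV fX Xx.
pose h e := leb (dyson_cap x e V X).
have [e01|e10] := leP e0 e1.
  have [||e] := @IVT _ h e0 e1 c e01 _ _; first exact: continuous_subspaceT.
    by rewrite ge_min le_max /h (ltW he0) (ltW h1) orbT.
  by rewrite in_itv/= /h => ee he; exists e; [lra|rewrite he c0 lexx].
have [||e] := @IVT _ h e1 e0 c (ltW e10) _ _; first exact: continuous_subspaceT.
  by rewrite ge_min le_max /h (ltW he0) (ltW h1) orbT.
by rewrite in_itv/= /h => ee he; exists e; [lra|rewrite he c0 lexx].
Qed.

(** A single point [v] of [V] suffices: [W] contains [X] rotated by [v]. *)
Lemma sumset_mod_ge (x : R) V X W : 0 < x ->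
    measurable X -> measurable W -> V `<=` `[0, x[ -> X `<=` `[0, x[ -> W `<=` `[0, x[ ->
    (forall v u, V v -> X u -> W (v + u) \/ W (v + u - x)) ->
  V !=set0 -> leb X <= leb W.
Proof.
move=> x0 mX mW Vx Xx Wx H [v Vv].
have := Vx _ Vv; rewrite /= in_itv/= => /andP[v0 vx].
have vx' : 0 <= v <= x by rewrite v0 ltW.
rewrite -(leb_rot mX Xx vx'); apply: le_leb.
- by apply: fm_measurable; apply: fm_rot.
- exact: (fmS mW (fm_itv true true 0 x) Wx).
have nW z : W z -> 0 <= z < x by move=> /Wx; rewrite /= in_itv.
move=> t /= []; rewrite in_itv/= => /andP[t0 tx] [] Xt; have := H _ _ Vv Xt.
  have -> : v + (t - v) = t by ring.
  by move=> [//|/nW /andP[? ?]]; exfalso; lra.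
have -> : v + (t - v + x) = t + x by ring.
by rewrite addrK => -[/nW /andP[? ?]|//]; exfalso; lra.
Qed.

(** Pigeonhole: [w - X] modulo [x], assembled from [Y1] and [Y2] according to whether the point of
    [X] is at most [w], must meet [V]. *)
Lemma sumset_mod_full (x : R) V X W : 0 < x ->
    measurable V -> measurable X -> V `<=` `[0, x[ -> X `<=` `[0, x[ ->
    (forall v u, V v -> X u -> W (v + u) \/ W (v + u - x)) -> W `<=` `[0, x[ ->
  x < leb V + leb X -> `[0, x[ `<=` W.
Proof.
move=> x0 mV mX Vx Xx H Wx VX w; rewrite /= in_itv/= => /andP[w0 wx].
have fV := fmS mV (fm_itv true true 0 x) Vx.
have fX := fmS mX (fm_itv true true 0 x) Xx.
have f1 : fm (X `&` `[0, w]) by apply: fmI.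
have f2 : fm (X `&` `]w, x[) by apply: fmI.
set Y1 := [set t | (X `&` `[0, w]) (w - t)].
set Y2 := [set t | (X `&` `]w, x[) (w + x - t)].
have fY1 : fm Y1 by apply: fm_reflect.
have fY2 : fm Y2 by apply: fm_reflect.
have Y12 : leb (Y1 `|` Y2) = leb X.
  rewrite lebU//; last first.
    apply/seteqP; split => t //=; rewrite /Y1 /Y2 /= !in_itv/=.
    move=> [[_ /andP[? ?]] [_ /andP[? ?]]].
    by lra.
  rewrite !leb_reflect; [|exact: fm_measurable|exact: fm_measurable].
  rewrite -lebU//; last first.
    apply/seteqP; split => t //=; rewrite /= !in_itv/= => -[[_ /andP[? ?]] [_ /andP[? ?]]].
    by lra.
  congr leb; apply/seteqP; split => t /=; first by move=> [[]|[]].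
  move=> Xt; have := Xx _ Xt; rewrite /= !in_itv/= => /andP[? ?].
  by have [?|?] := leP t w; [left|right]; split => //; lra.
have : 0 < leb (V `&` (Y1 `|` Y2)).
  have := lebUI fV (fmU fY1 fY2); rewrite Y12.
  suff : leb (V `|` (Y1 `|` Y2)) <= x by lra.
  rewrite -[leRHS]subr0 -(@leb_itv _ true true 0 x); last exact: ltW.
  apply: le_leb; [by apply: fm_measurable; do 2?apply: fmU|exact: fm_itv|].
  move=> t [/Vx//|]; rewrite /Y1 /Y2 /= !in_itv/= => -[[/Xx + /andP[? ?]]|[/Xx + /andP[? ?]]];
  by rewrite /= in_itv/= => /andP[? ?]; lra.
move=> /leb_gt0_ex[t [Vt]].
have nW z : W z -> 0 <= z < x by move=> /Wx; rewrite /= in_itv.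
move=> [[Xt _]|[Xt _]]; have := H _ _ Vt Xt.
  have -> : t + (w - t) = w by ring.
  by move=> [//|/nW /andP[? ?]]; exfalso; lra.
have -> : t + (w + x - t) = w + x by ring.
by rewrite addrK => -[/nW /andP[? ?]|//]; exfalso; lra.
Qed.

(* Raikov's inequality on the circle [R / x Z], realised on [0, x[. Dyson's
   transform replaces [V] and [X] by two sets with the same total measure and
   with sumset still in [W]; averaging over [e] lets [leb V] decrease to [0]. *)
Lemma raikov (x : R) V X W : 0 < x ->
    measurable V -> measurable X -> measurable W ->
    V `<=` `[0, x[ -> X `<=` `[0, x[ -> W `<=` `[0, x[ ->
    (forall v u, V v -> X u -> W (v + u) \/ W (v + u - x)) ->
    0 < leb V -> 0 < leb X ->
  Num.min x (leb V + leb X) <= leb W.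
Proof.
move=> x0 mV mX mW Vx Xx Wx H V0 X0.
have fW := fmS mW (fm_itv true true 0 x) Wx.
have [VX|VX] := ltP x (leb V + leb X).
  have h := sumset_mod_full x0 mV mX Vx Xx H Wx VX.
  have := le_leb (measurable_itv _) fW h.
  by rewrite leb_itv ?subr0//; exact: ltW.
set s := leb V + leb X in VX *.
(* The values [leb V'] over all pairs with the same total [s] and with sums still in [W]. *)
pose E := [set v | exists V' X', [/\ measurable V' /\ measurable X',
  (V' `<=` `[0, x[%classic) /\ (X' `<=` `[0, x[%classic),
  forall v u, V' v -> X' u -> W (v + u) \/ W (v + u - x),
  0 < leb V' /\ 0 < leb X' & leb V' + leb X' = s /\ leb V' = v]].
have Elb : lbound E 0 by move=> _ [V' [X' [_ _ _ _ [_ <-]]]]; exact: leb_ge0.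
have hE : has_inf E.
  by split; [exists (leb V), V, X; split|exists 0].
(* As [leb X' = s - v <= x - v], the mean of [leb (dyson_cap ...)] is at most [v - v^2 / x],
   strictly below [v - v^2 / (2x)]. *)
have Estep v : E v -> exists2 v', E v' & v' <= v - v ^+ 2 / (2 * x).
  move=> [V' [X' [[mV' mX'] [Vx' Xx'] H' [V0' X0'] [sVX <-]]]].
  have vx : 0 < leb V' * (1 - leb V' / (2 * x)).
    rewrite mulr_gt0// subr_gt0 ltr_pdivrMr ?mulr_gt0// mul1r; lra.
  have vs : leb V' * leb X' < leb V' * (1 - leb V' / (2 * x)) * x.
    rewrite -mulrA ltr_pM2l//.
    have -> : (1 - leb V' / (2 * x)) * x = x - leb V' / 2 by field; rewrite gt_eqF.
    lra.
  have [e /andP[e0 ex] /andP[he0 he]] := dyson_small x0 mV' mX' Vx' Xx' V0' X0' vx vs.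
  have fV' := fmS mV' (fm_itv true true 0 x) Vx'.
  have fX' := fmS mX' (fm_itv true true 0 x) Xx'.
  exists (leb (dyson_cap x e V' X')); last first.
    by apply: le_trans he _; rewrite mulrBr mulr1 expr2 mulrA.
  exists (dyson_cap x e V' X'), (dyson_cup x e V' X').
  have fC := fm_dyson_cap x e fV' fX'.
  have fU : fm (dyson_cup x e V' X') by apply: fmU => //; exact: fm_rot.
  have mC := fm_measurable fC; have mU := fm_measurable fU.
  split => //.
  - by split; [move=> t [/Vx']|move=> t [/Xx'|[]]].
  - exact: dyson_sub.
  - split=> //; apply: lt_le_trans X0' _; apply: le_leb => //.
    by move=> t; left.
  - by split => //; rewrite leb_dyson// e0 ltW.
(* A value close enough to a positive infimum [m] would be lowered by at least [m^2 / (2x)], to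
   below [m]. *)
have E0 : inf E <= 0.
  rewrite leNgt; apply/negP => m0.
  have d0 : 0 < inf E ^+ 2 / (2 * x) by rewrite divr_gt0 ?exprn_gt0 ?mulr_gt0.
  have [v Ev vm] := inf_adherent d0 hE.
  have [v' Ev' v'v] := Estep _ Ev.
  have Ev'm : inf E <= v' by apply: ge_inf => //; case: hE.
  have Evm : inf E <= v by apply: ge_inf => //; case: hE.
  have : inf E ^+ 2 / (2 * x) <= v ^+ 2 / (2 * x).
    by rewrite ler_pM2r ?invr_gt0 ?mulr_gt0// ler_sqr ?nnegrE; lra.
  by lra.
(* Once [leb V' < eps], the other set has measure above [s - eps], and [W] contains a rotation of
   it. *)
apply/ler_addgt0Pr => eps eps0.
have [v [V' [X' [[mV' mX'] [Vx' Xx'] H' [V0' X0'] [sVX Vv]]]] vm] := inf_adherent eps0 hE.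
have := sumset_mod_ge x0 mX' mW Vx' Xx' Wx H' (leb_gt0_ex V0').
lra.
Qed.

End circle_sumsets.

(** * Distribution functions and crossings *)

Section cumulative.
Variable R : realType.
Implicit Types X Y A B S : set R.

Definition cum X (x : R) : R := leb (X `&` `[0, x]).

(** The set [e - X], as a preimage so that measurability and [reflK] are immediate. *)
Definition refl (e : R) X : set R := [set t | X (e - t)].

Lemma reflK (e : R) X : refl e (refl e X) = X.
Proof. by apply/seteqP; split => t; rewrite /refl /= subKr. Qed.

Lemma fm_cum X (x : R) : measurable X -> fm (X `&` `[0, x]).
Proof. by move=> mX; apply: fmIr => //; exact: fm_itv. Qed.

Lemma cum_le X (p q : R) : measurable X -> p <= q -> cum X p <= cum X q.
Proof.
move=> mX pq; apply: le_leb; [by apply: fm_measurable; apply: fm_cum|exact: fm_cum|].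
by move=> t /=; rewrite !in_itv/= => -[? /andP[? ?]]; split => //; lra.
Qed.

Lemma cum_split X (p q : R) : measurable X -> 0 <= p <= q ->
  cum X q = cum X p + leb (X `&` `]p, q]).
Proof.
move=> mX /andP[p0 pq]; rewrite -lebU.
- congr leb; apply/seteqP; split => t /=; rewrite !in_itv/=.
    move=> [? /andP[? ?]]; have [?|?] := leP t p; [left|right]; split => //; lra.
  by move=> [[? /andP[? ?]]|[? /andP[? ?]]]; split => //; lra.
- exact: fm_cum.
- by apply: fmIr => //; exact: fm_itv.
apply/seteqP; split => t //=; rewrite !in_itv/= => -[[_ /andP[? ?]] [_ /andP[? ?]]].
by lra.
Qed.

Lemma cum_lip X (p q : R) : measurable X -> p <= q -> cum X q <= cum X p + (q - p).
Proof.
move=> mX pq.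
have f1 := fm_cum p mX; have f2 : fm `]p, q] by exact: fm_itv.
have := lebUI f1 f2; rewrite (leb_itv _ _ pq).
have := leb_ge0 ((X `&` `[0, p]) `&` `]p, q]).
suff : cum X q <= leb ((X `&` `[0, p]) `|` `]p, q]) by rewrite /cum; lra.
apply: le_leb; [by apply: fm_measurable; apply: fm_cum|exact: fmU|].
move=> t /=; rewrite !in_itv/= => -[? /andP[? ?]].
by have [?|?] := leP t p; [left; split => //|right]; lra.
Qed.

Lemma cum0 X : measurable X -> cum X 0 = 0.
Proof.
move=> mX; apply: (@leb_null _ _ [set 0]) => //; [|exact: fm_set1| |exact: leb_set1].
  by apply: fm_measurable; apply: fm_cum.
by move=> t /=; rewrite in_itv/= => -[_ h]; apply/le_anti; lra.
Qed.

Lemma cum_full X (a x : R) : X `<=` `[0, a] -> a <= x -> cum X x = leb X.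
Proof.
move=> Xa ax; congr leb; apply/seteqP; split => [t []//|t Xt]; split => //.
by have := Xa _ Xt; rewrite /= !in_itv/= => ?; lra.
Qed.

Lemma leb_eq_upto_point X Y (y : R) : measurable X -> fm Y ->
  X `<=` Y -> Y `<=` X `|` [set y] -> leb X = leb Y.
Proof.
move=> mX fY XY YX; rewrite (lebID fY mX) (setIidr XY).
rewrite (@leb_null _ (Y `\` X) [set y]) ?addr0//.
- by apply: measurableD => //; exact: fm_measurable.
- exact: fm_set1.
- by move=> t [/YX[]].
- exact: leb_set1.
Qed.

Lemma cum_open X (x : R) : measurable X -> leb (X `&` `[0, x[) = cum X x.
Proof.
move=> mX; apply: (@leb_eq_upto_point _ _ x); first exact: measurableI.
- exact: fm_cum.
- by move=> t /=; rewrite !in_itv/= => -[? /andP[? ?]]; split => //; lra.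
move=> t /=; rewrite !in_itv/= => -[? /andP[? tx]].
move: tx; rewrite le_eqVlt => /orP[/eqP ->|?]; [by right|left; split => //; lra].
Qed.

Lemma cum_refl X (a y : R) : measurable X -> X `<=` `[0, a] -> 0 <= y <= a ->
  cum (refl a X) y = leb X - cum X (a - y).
Proof.
move=> mX Xa /andP[y0 ya].
have mrX : measurable (refl a X) by exact: measurable_reflect.
have h : 0 <= a - y <= a by lra.
rewrite -(cum_full Xa (lexx a)) (cum_split mX h) addrAC subrr add0r -cum_open//.
have m1 : measurable (X `&` `]a - y, a]) by apply: measurableI.
rewrite -(leb_reflect a m1); congr leb; apply/seteqP.
by split => t; rewrite /refl /= !in_itv/= => -[? /andP[? ?]]; split => //; lra.
Qed.

Lemma leb_pigeonhole X Y (p q : R) : measurable X -> measurable Y ->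
  X `<=` `[p, q] -> Y `<=` `[p, q] -> p <= q -> q - p < leb X + leb Y ->
  exists2 t, X t & Y t.
Proof.
move=> mX mY Xp Yp pq XY.
have fX := fm_bounded mX Xp; have fY := fm_bounded mY Yp.
have : 0 < leb (X `&` Y).
  have := lebUI fX fY; suff : leb (X `|` Y) <= q - p by lra.
  rewrite -(leb_itv true false pq); apply: le_leb.
  - exact: measurableU.
  - exact: fm_itv.
  - by move=> t [/Xp|/Yp].
by move=> /leb_gt0_ex[t [? ?]]; exists t.
Qed.

(** * Zeros and level crossings of 1-Lipschitz functions *)

Section crossings.
Variable f : R -> R.
Hypothesis f_lip : forall p q, p <= q -> `|f q - f p| <= q - p.

Lemma last_zero (p q : R) : p <= q -> f p <= 0 -> 0 < f q ->
  exists b, [/\ p <= b < q, f b = 0 & forall t : R, b < t <= q -> 0 < f t].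
Proof.
move=> pq fp fq; pose Z := [set t | p <= t <= q /\ f t <= 0].
have Zp : Z p by split => //; rewrite lexx.
have hZ : has_sup Z by split; [exists p|exists q => t [/andP[]]].
have Zub t : Z t -> t <= sup Z by move=> ?; apply: ub_le_sup => //; case: hZ.
have pb := Zub _ Zp.
have bq : sup Z <= q by apply: ge_sup; [exists p|move=> t [/andP[]]].
have fb0 : f (sup Z) <= 0.
  rewrite leNgt; apply/negP => fb.
  have [z Zz bz] := sup_adherent fb hZ.
  have := f_lip (Zub _ Zz); rewrite ler_norml => /andP[? ?].
  by have [_ ?] := Zz; lra.
have bltq : sup Z < q by rewrite lt_neqAle bq andbT; apply/eqP => e; rewrite e in fb0; lra.
have fpos t : sup Z < t <= q -> 0 < f t.
  move=> /andP[bt tq]; rewrite ltNge; apply/negP => ft.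
  by have := Zub t; rewrite leNgt bt => /(_ _)/negP; apply; split => //; lra.
exists (sup Z); split => //; first by rewrite pb.
apply/le_anti; rewrite fb0/= leNgt; apply/negP => fb.
(* If [f] were negative at the supremum, the Lipschitz bound would keep it nonpositive for a while
   beyond it. *)
have [t [bt tq tb]] : exists t, [/\ sup Z < t, t <= q & t <= sup Z - f (sup Z)].
  exists (Num.min q (sup Z - f (sup Z))); rewrite lt_min !ge_min !lexx orbT bltq.
  by split => //=; lra.
have := f_lip (ltW bt); rewrite ler_norml => /andP[_ ?].
have btq : sup Z < t <= q by rewrite bt.
by have := fpos _ btq; lra.
Qed.

End crossings.

Lemma first_hit (f : R -> R) (c p q : R) :
  (forall p q, p <= q -> `|f q - f p| <= q - p) ->
  p <= q -> f p < c -> c <= f q ->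
  exists g, [/\ p < g <= q, f g = c & forall t : R, p <= t < g -> f t < c].
Proof.
move=> f_lip pq fp fq.
(* Reversing the line turns the last zero of [c - f (- x)] into the first point where [f] reaches
   [c]. *)
have [||||b [/andP[b1 b2] fb Hb]] := @last_zero (fun x => c - f (- x)) _ (- q) (- p).
- move=> x y xy; have := @f_lip (- y) (- x); rewrite lerN2 => /(_ xy).
  by rewrite !ler_norml; lra.
- by rewrite lerN2.
- by rewrite opprK; lra.
- by rewrite opprK; lra.
exists (- b); split; [by lra|by lra|move=> t /andP[? ?]].
have := Hb (- t); rewrite opprK => h; suff : 0 < c - f t by lra.
by apply: h; lra.
Qed.

End cumulative.

(** * Critical points of the excess function *)

Section critical_points.
Variable R : realType.
Implicit Types A B S X Y : set R.

Definition excess A B (x : R) : R := cum A x + cum B x - x.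

(** The slope is the density of [A] plus that of [B] minus 1, hence between -1 and 1. *)
Lemma excess_lip A B (p q : R) : measurable A -> measurable B -> p <= q ->
  `|excess A B q - excess A B p| <= q - p.
Proof.
move=> mA mB pq.
have := cum_le mA pq; have := cum_le mB pq.
have := cum_lip mA pq; have := cum_lip mB pq.
by rewrite /excess ler_norml => *; apply/andP; split; lra.
Qed.

Lemma full_itv B (p q : R) : measurable B -> p <= q -> leb (`]p, q[ `\` B) = 0 ->
  q - p <= leb (B `&` `]p, q]).
Proof.
move=> mB pq N.
have f1 : fm (B `&` `]p, q]) by apply: fmIr => //; exact: fm_itv.
rewrite -(leb_itv false true pq); apply: leb_le_ae => //; first exact: fm_itv.
apply: leb_null N; first by apply: measurableD => //; exact: fm_measurable.
  by apply: fmD => //; exact: fm_itv.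
move=> t /= [tpq nB]; split => // Bt; apply: nB; split => //.
by move: tpq; rewrite !in_itv/=; lra.
Qed.

(** The normalised situation: measurable sets containing their endpoints. [S] need only contain the
    sumset and have measure at most [a + leb B]; [sc_lt] is the strict hypothesis after cancelling
    one [leb B]. *)
Record sum_config A B S (a d : R) : Prop := SumConfig {
  sc_mA : measurable A; sc_mB : measurable B; sc_mS : measurable S;
  sc_A : A `<=` `[0, a]; sc_B : B `<=` `[0, d]; sc_S : S `<=` `[0, a + d];
  sc_A0 : A 0; sc_Aa : A a; sc_B0 : B 0; sc_Bd : B d;
  sc_sum : forall u v, A u -> B v -> S (u + v);
  sc_le : leb S <= a + leb B;
  sc_lt : a < leb A + leb B;
  sc_d : 0 < d <= a }.

Lemma sum_config_refl A B S (a d : R) : sum_config A B S a d ->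
  sum_config (refl a A) (refl d B) (refl (a + d) S) a d.
Proof.
case=> mA mB mS Aa Bd Sad A0 Aa' B0 Bd' sumS leS ltS d0.
split; rewrite /refl/= ?subr0 ?subrr// ?leb_reflect//; try exact: measurable_reflect.
- by move=> t /= /Aa; rewrite /= !in_itv/=; lra.
- by move=> t /= /Bd; rewrite /= !in_itv/=; lra.
- by move=> t /= /Sad; rewrite /= !in_itv/=; lra.
- move=> u v Au Bv; have := sumS _ _ Au Bv.
  by have -> : a - u + (d - v) = a + d - (u + v) by ring.
Qed.

Section config.
Variables (A B S : set R) (a d : R).
Hypothesis cfg : sum_config A B S a d.

Let mA := sc_mA cfg.
Let mB := sc_mB cfg.
Let mS := sc_mS cfg.
Local Notation f := (excess A B).
Local Notation delta := (leb A + leb B - a).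

Let d0 : 0 < d. Proof. by have /andP[] := sc_d cfg. Qed.
Let da : d <= a. Proof. by have /andP[] := sc_d cfg. Qed.
Let delta0 : 0 < delta. Proof. by have := sc_lt cfg; lra. Qed.
Let f_lip (p q : R) : p <= q -> `|f q - f p| <= q - p. Proof. exact: excess_lip. Qed.
Let Ba : B `<=` `[0, a].
Proof. by move=> t /(sc_B cfg); rewrite /= !in_itv/=; have := da; lra. Qed.
Let fA := fm_bounded mA (sc_A cfg).
Let fB := fm_bounded mB (sc_B cfg).
Let fS := fm_bounded mS (sc_S cfg).

Lemma excess0 : f 0 = 0.
Proof. by rewrite /excess !cum0// subr0 addr0. Qed.

Lemma excessa : f a = delta.
Proof. by rewrite /excess (cum_full (sc_A cfg))// (cum_full Ba). Qed.

(** Inside [0, x] the sets [A] and [x - B] have total measure [f x + x > x], so they meet. *)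
Lemma excess_gt0_in (x : R) : 0 <= x -> 0 < f x -> S x.
Proof.
move=> x0; rewrite /excess => fx.
pose Y := [set t | (B `&` `[0, x]) (x - t)].
have mBx := fm_measurable (fm_cum x mB).
have [||||| |t] := @leb_pigeonhole _ (A `&` `[0, x]) Y 0 x.
- exact: measurableI.
- exact: measurable_reflect.
- by move=> t [].
- by move=> t [_]; rewrite /= !in_itv/=; lra.
- by [].
- by rewrite leb_reflect// subr0; move: fx; rewrite /cum; lra.
move=> [At _] [Bt _].
by have := sc_sum cfg At Bt; have -> : t + (x - t) = x by ring.
Qed.

(** Inside [x, a] the sets [A] and [x + a - B] have total measure [delta - f x + a - x > a - x], so
    they meet. *)
Lemma excess_lt_in (x : R) : 0 <= x <= a -> f x < delta -> S (x + a).
Proof.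
move=> /andP[x0 xa]; rewrite /excess => fx.
have xa' : 0 <= x <= a by rewrite x0.
have := cum_split mA xa'; have := cum_split mB xa'.
rewrite (cum_full (sc_A cfg))// (cum_full Ba)// => hB hA.
pose Y := [set t | (B `&` `]x, a]) (x + a - t)].
have mBx : measurable (B `&` `]x, a]) by exact: measurableI.
have [||||| |t] := @leb_pigeonhole _ (A `&` `]x, a]) Y x a.
- exact: measurableI.
- exact: measurable_reflect.
- by move=> t [_]; rewrite /= !in_itv/=; lra.
- by move=> t [_]; rewrite /= !in_itv/=; lra.
- by [].
- by rewrite leb_reflect//; lra.
move=> [At _] [Bt _].
by have := sc_sum cfg At Bt; have -> : t + (x + a - t) = x + a by ring.
Qed.

(** The residues modulo [a] met twice by [S], at [t] and at [t + a]. *)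
Definition overlap : set R := `[0, a[ `&` (S `&` [set t | S (t + a)]).

Lemma fm_overlap : fm overlap.
Proof.
apply: fmI; first exact: fm_itv.
by apply: measurableI => //; exact: measurable_translate.
Qed.

(* Every residue class modulo [a] meets [S], and those of the points of [B]
   meet it twice, so [leb S <= a + leb B] leaves no room for other overlaps. *)
Lemma overlap_config : leb (overlap `\` B) = 0 /\ leb S = a + leb B.
Proof.
pose N1 := S `&` `[0, a[; pose T := S `&` `[a, a + a[.
pose N2 := [set t | T (t + a)].
have fN1 : fm N1 by exact: fmI.
have fT : fm T by exact: fmI.
have fN2 : fm N2 by exact: fm_translate.
have lN2 : leb N2 = leb T by apply: leb_translate; exact: fm_measurable.
have N12 : N1 `&` N2 = overlap.
  apply/seteqP; split => t; rewrite /N1 /N2 /T /overlap /= !in_itv/=.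
    by move=> [[? ?] [? ?]].
  by move=> [/andP[? ?] [? ?]]; do 2!split => //; lra.
(* Every [t] in [0, a[ has [f t > 0] or [f t < delta], so [t] or [t + a] is in [S]. *)
have U12 : leb (N1 `|` N2) = a.
  rewrite -[RHS]subr0 -(@leb_itv _ true true 0 a); last by have := d0; have := da; lra.
  congr leb; apply/seteqP; split => t; rewrite /N1 /N2 /T /= !in_itv/=.
    by move=> [[_ //]|[_ /andP[? ?]]]; lra.
  move=> /andP[t0 ta]; have [ft|ft] := ltP 0 (f t).
    by left; split; [exact: excess_gt0_in|rewrite t0].
  right; split; last lra.
  by apply: excess_lt_in; [lra|have := delta0; lra].
have S12 : leb N1 + leb N2 <= leb S.
  rewrite lN2 -lebU//.
    by apply: le_leb => //; [apply: fm_measurable; exact: fmU|move=> t [[]|[]]].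
  apply/seteqP; split => t //=.
  rewrite /N1 /T /= !in_itv/= => -[[_ /andP[? ?]] [_ /andP[? ?]]]; lra.
have UI := lebUI fN1 fN2; rewrite N12 U12 in UI.
(* Since 0 and [a] are in [A], each point of [B] other than [a] is an overlap. *)
have Bov : leb B <= leb (overlap `&` B).
  have := @leb_eq_upto_point _ (B `&` `[0, a[) B a _ fB _ _ => <-.
  - apply: le_leb; [exact: measurableI|apply: fmI => //; exact: fm_overlap|].
    move=> t [Bt ta]; split => //; split => //=; split.
      by rewrite -[t]add0r; exact: (sc_sum cfg (sc_A0 cfg) Bt).
    by rewrite addrC; exact: (sc_sum cfg (sc_Aa cfg) Bt).
  - exact: measurableI.
  - by move=> t [].
  - move=> t Bt; have := Ba Bt; rewrite /= !in_itv/= => /andP[t0].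
    by rewrite le_eqVlt => /orP[/eqP->|ta]; [right|left; rewrite t0].
(* The overlap has measure at most [leb S - a <= leb B], and its part in [B] already reaches
   [leb B]: all these are equalities. *)
have := lebID fm_overlap mB; have := leb_ge0 (overlap `\` B).
by have := sc_le cfg; split; lra.
Qed.

Lemma overlap_null X : measurable X -> X `<=` overlap -> leb (X `\` B) = 0.
Proof.
move=> mX XO; have [h _] := overlap_config.
apply: leb_null h; [exact: measurableD|by apply: fmD => //; exact: fm_overlap|].
by move=> t [/XO].
Qed.

Lemma between_sub (p q : R) : 0 <= p -> q <= a ->
    (forall t : R, p < t < q -> 0 < f t < delta) -> `]p, q[ `<=` overlap.
Proof.
move=> p0 qa H t; rewrite /= in_itv/= => tpq; have /andP[? ?] := H _ tpq.
split; first by rewrite /= in_itv/=; lra.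
by split => /=; [apply: excess_gt0_in|apply: excess_lt_in]; lra.
Qed.

(** Where [0 < f < delta], [B] has full density, which cancels the term [- x] and leaves the density
    of [A] as slope. *)
Lemma excess_between (p q : R) : 0 <= p <= q -> q <= a ->
    (forall t : R, p < t < q -> 0 < f t < delta) ->
  f q = f p + leb (A `&` `]p, q]).
Proof.
move=> /andP[p0 pq] qa H.
have pq0 : 0 <= p <= q by rewrite p0.
have := overlap_null (measurable_itv _) (between_sub p0 qa H) => N.
have f1 : fm (B `&` `]p, q]) by exact: fmI.
have h1 := full_itv mB pq N.
have h2 : leb (B `&` `]p, q]) <= q - p.
  rewrite -(leb_itv false false pq); apply: le_leb; [exact: fm_measurable|exact: fm_itv|].
  by move=> t [].
by rewrite /excess (cum_split mA pq0) (cum_split mB pq0); lra.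
Qed.

(** [b] is the last zero. A positive value before [b] would be followed by a first return to 0 at
    some [y]; but just before [y] the excess lies between 0 and [delta], where it cannot
    decrease. *)
Lemma critical_b : exists b : R, [/\ 0 <= b < a, f b = 0,
  forall t : R, 0 <= t <= b -> f t <= 0 & forall t : R, b < t <= a -> 0 < f t].
Proof.
have a0 : 0 <= a by have := d0; have := da; lra.
have [||b [/andP[b0 ba] fb fpos]] := last_zero f_lip a0.
- by rewrite excess0.
- by rewrite excessa.
exists b; split => //; first by rewrite b0.
move=> t /andP[t0 tb]; rewrite leNgt; apply/negP => ft.
have [|||y [/andP[ty yb] fy H]] := @first_hit _ (fun x => - f x) 0 t b _ tb.
- by move=> p q pq; have := f_lip pq; rewrite !ler_norml; lra.
- by lra.
- by lra.
have {}fy : f y = 0 by lra.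
(* Within [delta / 2] of [y] the Lipschitz bound keeps [f] below [delta]. *)
pose x := Num.max t (y - delta / 2).
have xy : x < y by rewrite /x gt_max ty /=; have := delta0; lra.
have tx : t <= x by rewrite /x le_max lexx.
have yx : y - delta / 2 <= x by rewrite /x le_max lexx orbT.
have fx : 0 < f x by rewrite -oppr_lt0; apply: H; rewrite tx.
have : f y = f x + leb (A `&` `]x, y]).
  apply: excess_between; [lra|lra|move=> u /andP[xu uy]].
  have := H u; rewrite oppr_lt0 => -> /=; last by lra.
  have := f_lip (ltW uy); rewrite ler_norml => /andP[? ?].
  by have := delta0; lra.
by have := leb_ge0 (A `&` `]x, y]); lra.
Qed.

(** [g] is the first point after [b] where [f] reaches [delta]. Between them [B] is full, so [g]
    cannot exceed [d], and [f] climbs by the measure of [A] there, at most [g - b]. *)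
Lemma critical_g (b : R) : 0 <= b < a -> f b = 0 -> (forall t : R, b < t <= a -> 0 < f t) ->
    (forall t : R, 0 <= t <= b -> f t <= 0) ->
  exists g, [/\ b < g <= d, f g = delta, forall t : R, 0 <= t < g -> f t < delta &
    delta <= g - b].
Proof.
move=> /andP[b0 ba] fb fpos fneg.
have [||g [/andP[bg ga] fg H]] := @first_hit _ f delta b a f_lip (ltW ba).
- by rewrite fb.
- by rewrite excessa.
have Hb t : b < t < g -> 0 < f t < delta.
  by move=> /andP[bt tg]; rewrite fpos ?H//; lra.
have bg0 : 0 <= b <= g by lra.
exists g; split => //.
- rewrite bg leNgt; apply/negP => dg.
  have := overlap_null (measurable_itv _) (between_sub b0 ga Hb) => N.
  pose p := Num.max b d.
  have pg : p < g by rewrite /p gt_max bg.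
  have : leb `]p, g[ = 0.
    apply: leb_null N; [exact: measurable_itv|by apply: fmD => //; exact: fm_itv|].
    move=> t; rewrite /= in_itv/= gt_max => /andP[/andP[bt dt] tg]; split.
      by rewrite /= in_itv/= bt.
    by move=> /(sc_B cfg); rewrite /= in_itv/=; lra.
  by rewrite leb_itv ?ltW//; lra.
- move=> t /andP[t0 tg]; have [tb|bt] := leP t b.
    by have := fneg t; rewrite t0 tb => /(_ isT); have := delta0; lra.
  by apply: H; rewrite tg ltW.
have := excess_between bg0 ga Hb; rewrite fg fb add0r => ->.
rewrite -(@leb_itv _ false false b g); last by lra.
apply: le_leb; [exact: measurableI|exact: fm_itv|by move=> t []].
Qed.

(** A point [t] of [S] with [f t <= 0 < delta] has [t + a] in [S] as well, hence is an overlap. *)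
Lemma low_null (c : R) : 0 <= c < a -> (forall t : R, 0 <= t <= c -> f t <= 0) ->
  leb ((S `&` `[0, c]) `\` B) = 0.
Proof.
move=> /andP[c0 ca] H; apply: overlap_null; first exact: measurableI.
move=> t [St]; rewrite /= in_itv/= => tc; split.
  by rewrite /= in_itv/=; lra.
split => //=; apply: excess_lt_in; first by lra.
by have := H _ tc; have := delta0; lra.
Qed.

End config.

(** When [S] contains [A + B], [le_null] is the stability of [B] below [b]: up to a null set, sums
    that stay in [0, b] fall back into [B]. *)
Record low_end A B S (b : R) : Prop := LowEnd {
  le_b0 : 0 <= b;
  le_zero : excess A B b = 0;
  le_neg : forall t : R, 0 <= t <= b -> excess A B t <= 0;
  le_null : leb ((S `&` `[0, b]) `\` B) = 0 }.

Record critical A B S (a d b c : R) : Prop := Critical {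
  cr_b : low_end A B S b;
  cr_c : low_end (refl a A) (refl d B) (refl (a + d) S) c;
  cr_bc : leb A + leb B - a <= d - c - b;
  cr_J : `]b, a + d - c[ `<=` S;
  cr_I : leb (`]b, d - c[ `\` B) = 0 }.

Lemma critical_refl A B S (a d b c : R) : measurable A -> measurable B ->
  critical A B S a d b c ->
  critical (refl a A) (refl d B) (refl (a + d) S) a d c b.
Proof.
move=> mA mB [lb lc bc J I]; split; rewrite ?reflK//.
- by rewrite !leb_reflect//; lra.
- by move=> t; rewrite /= in_itv/= => ?; apply: J; rewrite /= in_itv/=; lra.
rewrite -I -[RHS](@leb_reflect _ d); last exact: measurableD.
congr leb; apply/seteqP; split => t; rewrite /refl /= !in_itv/= => -[? ?];
by split => //; lra.
Qed.

Lemma critical_exists A B S (a d : R) : sum_config A B S a d ->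
  exists b c, critical A B S a d b c.
Proof.
move=> cfg; have cfg' := sum_config_refl cfg.
have [b [b0 fb fneg fpos]] := critical_b cfg.
have [g [/andP[bg gd] fg gneg gb]] := critical_g cfg b0 fb fpos fneg.
have [b' [b'0 fb' fneg' fpos']] := critical_b cfg'.
have [[mA mB] mS] := (sc_mA cfg, sc_mB cfg, sc_mS cfg).
have /andP[d0 da] := sc_d cfg.
(* [b'] is the critical point of the reflected sets. The bound [d - g] keeps [g <= d - c], so that
   [d - c - b >= g - b >= delta]. *)
pose c := Num.min b' (d - g).
have cb' : c <= b' by rewrite /c ge_min lexx.
have cdg : c <= d - g by rewrite /c ge_min lexx orbT.
have c0 : 0 <= c by rewrite /c le_min; lra.
have fcneg t : 0 <= t <= c -> excess (refl a A) (refl d B) t <= 0.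
  by move=> tc; apply: fneg'; lra.
(* If [c = d - g], the reflected excess at [c] is at least [delta - f g = 0], and it is nonpositive
   up to [b']. *)
have fc : excess (refl a A) (refl d B) c = 0.
  have [h|h] := leP b' (d - g); first by rewrite /c min_l.
  have cE : c = d - g by rewrite /c min_r// ltW.
  apply/le_anti/andP; split; first by apply: fcneg; rewrite c0 lexx.
  rewrite /excess (cum_refl mA (sc_A cfg)); last by lra.
  rewrite (cum_refl mB (sc_B cfg)); last by lra.
  have -> : d - c = g by rewrite cE; ring.
  have ga : g <= a - c by lra.
  by have := cum_lip mA ga; move: fg; rewrite /excess; lra.
(* Three ranges: up to [a], positivity of [f]; up to [a + g], the bound [f < delta] at [t - a];
   beyond, where necessarily [c = b'], positivity of the reflected excess. *)
have J : `]b, a + d - c[ `<=` S.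
  move=> t; rewrite /= in_itv/= => /andP[bt tc].
  have [ta|ta] := leP t a.
    by apply: (excess_gt0_in cfg); [lra|apply: fpos; rewrite bt].
  have [tg|tg] := ltP (t - a) g.
    have := @excess_lt_in _ _ _ _ _ cfg (t - a).
    by rewrite subrK; apply; [lra|apply: gneg; lra].
  have h : b' < a + d - t.
    have [h|h] := leP b' (d - g); move: tc.
      by rewrite /c min_l//; lra.
    by rewrite /c min_r; lra.
  have := @excess_gt0_in _ _ _ _ _ cfg' (a + d - t).
  rewrite /refl /= subKr; apply; first by lra.
  by apply: fpos'; lra.
exists b, c; split => //.
- by split => //; [lra|exact: (low_null cfg)].
- by split => //; apply: (low_null cfg') => //; lra.
- by lra.
(* For [t] in ]b, d - c[ both [t] and [t + a] lie in ]b, a + d - c[. *)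
apply: (overlap_null cfg); first exact: measurable_itv.
move=> t; rewrite /= in_itv/= => tI; split; first by rewrite /= in_itv/=; lra.
by split => /=; apply: J; rewrite /= in_itv/=; lra.
Qed.

(** From [f p <= 0 = f b], the sets [A] and [B] have total measure at least [b - p] on ]p, b]. There
    [A], being part of [S], lies in [B] almost everywhere, so [B] has at least half. *)
Lemma low_end_half A B S (b p : R) :
  measurable A -> measurable B -> measurable S -> A `<=` S ->
  low_end A B S b -> 0 <= p <= b -> (b - p) / 2 <= cum B b - cum B p.
Proof.
move=> mA mB mS AS [b0 fb fneg null] /andP[p0 pb].
have pb0 : 0 <= p <= b by rewrite p0.
have fp : excess A B p <= 0 by exact: fneg.
have fA : fm (A `&` `]p, b]) by apply: fmIr => //; exact: fm_itv.
have fB : fm (B `&` `]p, b]) by apply: fmIr => //; exact: fm_itv.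
have : leb (A `&` `]p, b]) <= leb (B `&` `]p, b]).
  apply: leb_le_ae => //; apply: leb_null null.
  - by apply: measurableD; exact: fm_measurable.
  - by apply: fmD => //; exact: fm_cum.
  move=> t [[At /= tp] nB]; split; last by move=> Bt; apply: nB.
  by split; [exact: AS|move: tp; rewrite /= !in_itv/=; lra].
move: fb fp; rewrite /excess (cum_split mA pb0) (cum_split mB pb0); lra.
Qed.

Lemma sum_config_sub A B S (a d : R) : sum_config A B S a d -> A `<=` S.
Proof.
by move=> cfg t At; rewrite -[t]addr0; exact: (sc_sum cfg At (sc_B0 cfg)).
Qed.

(* The half-density threshold of [B] cannot lie to the right of [b]: [B] has
   density at least [1/2] on [0, b], is full on [b, d - c], and by the
   reflected condition has density at least [1/2] on each [d - c, x]. *)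
Lemma half_density_le A B S (a d b c x : R) : sum_config A B S a d ->
  critical A B S a d b c -> 0 <= x <= d -> cum B x <= x / 2 -> x <= b.
Proof.
move=> cfg [lb lc bc J I] /andP[x0 xd] Bx; rewrite leNgt; apply/negP => bx.
have cfg' := sum_config_refl cfg.
have [[mA mB] mS] := (sc_mA cfg, sc_mB cfg, sc_mS cfg).
have b0 := le_b0 lb; have c0 := le_b0 lc; have ltS := sc_lt cfg.
have b00 : (0 : R) <= 0 <= b by rewrite lexx.
have hb := low_end_half mA mB mS (sum_config_sub cfg) lb b00.
rewrite cum0// in hb.
have mid y : b <= y <= d - c -> cum B b + (y - b) <= cum B y.
  move=> /andP[by1 yc]; rewrite (@cum_split _ B b y)//; last by rewrite b0.
  rewrite lerD2l; apply: full_itv => //.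
  apply: leb_null I; [exact: measurableD|by apply: fmD => //; exact: fm_itv|].
  by move=> t /= []; rewrite !in_itv/= => ? ?; split => //; lra.
have [xc|xc] := leP x (d - c).
  by have := mid x; rewrite xc ltW// => /(_ isT); lra.
have yc : 0 <= d - x <= c by lra.
have := low_end_half (sc_mA cfg') (sc_mB cfg') (sc_mS cfg') (sum_config_sub cfg') lc yc.
rewrite !(cum_refl mB (sc_B cfg)); [|by lra|by lra].
rewrite subKr; have := mid (d - c); rewrite lexx andbT => m.
have {m} := m _; have -> : b <= d - c by lra.
by move=> /(_ isT); lra.
Qed.

End critical_points.

(** * Quadratic bound for stable sets *)

Section quadratic_bound.
Variable R : realType.
Implicit Types A B S T : set R.

(** The part of [T] in [xj, xj + x[, moved to [0, x[. *)
Definition layer (x : R) T (j : nat) : set R := `[0, x[ `&` [set t | T (t + x * j%:R)].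

Lemma fm_layer (x : R) T j : measurable T -> fm (layer x T j).
Proof. by move=> mT; apply: fmI; [exact: fm_itv|exact: measurable_translate]. Qed.

Lemma layer_ae (x : R) T T' j : measurable T -> measurable T' ->
  fm (T' `\` T) -> leb (T' `\` T) = 0 -> leb (layer x T' j `\` layer x T j) = 0.
Proof.
move=> mT mT' fD N.
apply: (@leb_null _ _ [set t | (T' `\` T) (t + x * j%:R)]).
- by apply: fm_measurable; apply: fmD; [exact: fm_layer|apply: fm_measurable; exact: fm_layer].
- exact: fm_translate.
- by move=> t [[tx Tt] nT]; split => // Tt'; apply: nT.
- by rewrite leb_translate//; exact: fm_measurable.
Qed.

Lemma leb_layers (x : R) T j : 0 < x -> measurable T ->
  leb (T `&` `[0, x * j.+1%:R[) = leb (T `&` `[0, x * j%:R[) + leb (layer x T j).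
Proof.
move=> x0 mT; set y := x * j%:R.
have y0 : 0 <= y by rewrite mulr_ge0// ltW.
have -> : x * j.+1%:R = y + x by rewrite -natr1 mulrDr mulr1.
have f1 : fm (T `&` `[0, y[) by apply: fmIr => //; exact: fm_itv.
have f2 : fm (T `&` `[y, y + x[) by apply: fmIr => //; exact: fm_itv.
have -> : layer x T j = [set t | (T `&` `[y, y + x[) (t + y)].
  apply/seteqP; split => t; rewrite /layer /= !in_itv/= -/y => -[? ?]; split => //; lra.
rewrite leb_translate; last exact: fm_measurable.
rewrite -lebU//; last first.
  apply/seteqP; split => t //=; rewrite !in_itv/= => -[[_ /andP[? ?]] [_ /andP[? ?]]].
  by lra.
congr leb; apply/seteqP; split => t /=; rewrite !in_itv/=.
  by move=> [? /andP[? ?]]; have [?|?] := ltP t y; [left|right]; split => //; lra.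
by move=> [[? /andP[? ?]]|[? /andP[? ?]]]; split => //; lra.
Qed.

(* Modulo [x], the layers of an [A]-stable set grow by at least
   [leb (A `&` `[0, x[)] at every step, by Raikov's inequality. *)
Lemma layer_growth (x : R) A T T' : 0 < x ->
    measurable A -> measurable T -> measurable T' ->
    fm (T' `\` T) -> leb (T' `\` T) = 0 ->
    (forall u v, A u -> T v -> T' (u + v)) -> A x -> A `&` `[0, x[ `<=` T' ->
    0 < leb (A `&` `[0, x[) ->
  forall j, Num.min x (j.+1%:R * leb (A `&` `[0, x[)) <= leb (layer x T j).
Proof.
move=> x0 mA mT mT' fD N H Ax AT' phi0; set V := (A `&` _) in AT' phi0 *.
have fV : fm V by apply: fmIr => //; exact: fm_itv.
have lae i := leb_le_ae (fm_layer x i mT') (fm_layer x i mT) (layer_ae x i mT mT' fD N).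
elim=> [|j IH].
  rewrite mul1r ge_min; apply/orP; right; apply: le_trans (lae 0%N).
  apply: le_leb; [exact: fm_measurable|exact: fm_layer|move=> t Vt].
  by split; [case: Vt|rewrite /= mulr0 addr0; exact: AT'].
have Xpos : 0 < leb (layer x T j).
  by apply: lt_le_trans IH; rewrite lt_min x0 mulr_gt0.
(* A sum that does not wrap stays in layer [j]. As [x] is in [A], layer [j] is contained in layer
   [j + 1] up to a null set, so [W] is no larger than the next layer. *)
pose W := layer x T' j `|` layer x T' j.+1.
have fW : fm W by apply: fmU; exact: fm_layer.
have WT : leb W <= leb (layer x T j.+1).
  apply: le_trans (lae j.+1); apply: leb_le_ae; [exact: fW|exact: fm_layer|].
  apply: leb_null (layer_ae x j mT mT' fD N).
  - by apply: measurableD; apply: fm_measurable => //; exact: fm_layer.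
  - by apply: fmD; [exact: fm_layer|apply: fm_measurable; exact: fm_layer].
  move=> t [[h|//] n]; split => // -[tx Tt]; apply: n; split => //=.
  by rewrite -natr1 mulrDr mulr1 addrA addrC; exact: H.
apply: le_trans WT.
have := @raikov _ x V (layer x T j) W x0 (fm_measurable fV)
  (fm_measurable (fm_layer x j mT)) (fm_measurable fW).
move=> /(_ _ _ _ _ phi0 Xpos) => rk.
apply: le_trans (rk _ _ _ _).
- rewrite le_min ge_min lexx /= -[j.+2%:R]natr1 mulrDl mul1r ge_min.
  by move: IH; rewrite ge_min => /orP[h|h]; apply/orP; [left|right]; lra.
- by move=> t [].
- by move=> t [].
- by move=> t [[]|[]].
move=> v u [Av /=]; rewrite in_itv/= => /andP[v0 vx] [/=].
rewrite in_itv/= => /andP[u0 ux] Tu.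
have := H _ _ Av Tu; rewrite addrA => T'vu.
have [vux|vux] := ltP (v + u) x; [left; left|right; right]; split => //=.
- by rewrite in_itv/=; lra.
- by rewrite in_itv/=; lra.
by rewrite -natr1 mulrDr mulr1 [_ + x]addrC addrA subrK.
Qed.

Lemma quadratic_mem A B S (b c1 x : R) :
    measurable A -> measurable B -> measurable S -> A `<=` S ->
    (forall t : R, A t -> 0 <= t) ->
    (forall u v, A u -> B v -> S (u + v)) ->
    leb ((S `&` `[0, b]) `\` B) = 0 ->
    c1 <= b -> cum B c1 <= c1 / 2 -> 0 < x <= c1 -> A x ->
  cum A x <= x ^+ 2 / c1.
Proof.
move=> mA mB mS AS A_ge0 H N c1b Bc1 /andP[x0 xc1] Ax.
rewrite leNgt; apply/negP => Fx.
have c10 : 0 < c1 by lra.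
(* Filling everything beyond [b] makes the set stable under all of [A], up to a null set. *)
pose T := (B `&` `[0, b]) `|` `]b, +oo[.
pose T' := (S `&` `[0, b]) `|` `]b, +oo[.
have mT : measurable T by apply: measurableU => //; exact: measurableI.
have mT' : measurable T' by apply: measurableU => //; exact: measurableI.
have TD : T' `\` T `<=` (S `&` `[0, b]) `\` B.
  move=> t [[[St tb]|tb] nT]; last by case: nT; right.
  by split => // Bt; apply: nT; left.
have fSB : fm ((S `&` `[0, b]) `\` B) by apply: fmD => //; exact: fm_cum.
have fD : fm (T' `\` T) by apply: fmS TD => //; exact: measurableD.
have ND : leb (T' `\` T) = 0 by apply: leb_null TD N => //; exact: fm_measurable.
have HT u v : A u -> T v -> T' (u + v).
  move=> Au Tv; have u0 := A_ge0 _ Au.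
  have [uvb|uvb] := leP (u + v) b; last by right; rewrite /= in_itv/= uvb.
  case: Tv => [[Bv]|]; rewrite /= in_itv/=; last by lra.
  move=> v0b; left; split; first exact: H.
  by rewrite /= in_itv/=; lra.
have phi0 : 0 < cum A x by apply: le_lt_trans Fx; rewrite divr_ge0 ?exprn_ge0// ltW.
have AT' : A `&` `[0, x[ `<=` T'.
  move=> t [At]; rewrite /= in_itv/= => tx; left; split; first exact: AS.
  by rewrite /= in_itv/=; lra.
have := layer_growth x0 mA mT mT' fD ND HT Ax AT'.
rewrite cum_open// => /(_ phi0) G.
pose m := Num.truncn (c1 / x).
have /andP[m1 m2] : m%:R <= c1 / x < m.+1%:R by apply: truncn_itv; rewrite divr_ge0 ?ltW.
have {}m1 : x * m%:R <= c1 by move: m1; rewrite ler_pdivlMr// mulrC.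
have {}m2 : c1 < x * m.+1%:R by move: m2; rewrite ltr_pdivrMr// mulrC.
pose th := x ^+ 2 / c1.
have thc : th * c1 = x ^+ 2 by rewrite /th divfK// gt_eqF.
have th0 : 0 < th by rewrite divr_gt0 ?exprn_gt0.
(* Layer [k] has measure at least [(k + 1) th], which is at most [x] while [(k + 1) x <= c1]; this
   sums the first [k] layers. *)
have g k : (k <= m)%N -> th * (k%:R * (k%:R + 1) / 2) <= leb (T `&` `[0, x * k%:R[).
  elim: k => [_|k IH km]; first by rewrite mul0r mul0r mulr0 leb_ge0.
  rewrite leb_layers//; apply: le_trans (lerD (IH (ltnW km)) (G k)).
  have km' : (k%:R + 1 : R) <= m%:R by rewrite natr1 ler_nat.
  have kx : (k%:R + 1) * th <= x.
    rewrite -(ler_pM2r c10) -mulrA thc.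
    have : x * (k%:R + 1) <= c1 by apply: le_trans m1; rewrite ler_pM2l.
    by rewrite -(ler_pM2l x0); nra.
  rewrite -natr1.
  have : (k%:R + 1) * th <= Num.min x ((k%:R + 1) * cum A x).
    rewrite le_min kx /= ler_pM2l; first exact: ltW.
    by rewrite natr1 ltr0n.
  by lra.
have gm := g _ (leqnn m).
(* Layer [m] is full, because [(m + 1) x > c1] gives [(m + 1) th > x]. *)
have lm : x <= leb (layer x T m).
  apply: le_trans (G m); rewrite le_min lexx /=.
  have m0 : 0 < m.+1%:R :> R by rewrite ltr0n.
  apply: (@le_trans _ _ (m.+1%:R * th)); last by rewrite ler_pM2l// ltW.
  by rewrite -(ler_pM2r c10) -mulrA thc; nra.
have gm1 := leb_layers m x0 mT.
rewrite cum_open// in gm1.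
have cT : cum T c1 = cum B c1.
  congr leb; apply/seteqP; split => t; rewrite /T /= !in_itv/=.
    by move=> [[[? _]|?] ?]; split => //; lra.
  by move=> [? ?]; split => //; left; split => //; lra.
have := cum_lip mT (ltW m2); rewrite cT gm1.
have mS1 : x * m.+1%:R = x * m%:R + x by rewrite -natr1 mulrDr mulr1.
rewrite mS1 in m2 *.
have mge1 : (1 : R) <= m%:R.
  rewrite ler1n lt0n; apply/negP => /eqP mE.
  by move: m2; rewrite mE mulr0 add0r; lra.
(* After multiplication by [2 c1] the difference of the two sides is [(c1 - x m)^2 + x^2 m], and
   [m >= 1]. *)
have key : c1 / 2 < th * (m%:R * (m%:R + 1) / 2) + c1 - x * m%:R.
  rewrite -(ltr_pM2r c10) mulrBl mulrDl [th * _ * c1]mulrAC thc.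
  have : 0 < x ^+ 2 * m%:R by rewrite mulr_gt0 ?exprn_gt0//; lra.
  have : 0 <= (c1 - x * m%:R) ^+ 2 by exact: sqr_ge0.
  by lra.
by lra.
Qed.

(** For [x] outside [A], replace it by the supremum [y] of [A] in [0, x], which leaves [cum A]
    unchanged. A violation at [y] persists, by Lipschitz continuity, at a nearby point of [A]. *)
Lemma quadratic A B S (b c1 x : R) :
    measurable A -> measurable B -> measurable S -> A `<=` S ->
    (forall t : R, A t -> 0 <= t) -> A 0 ->
    (forall u v, A u -> B v -> S (u + v)) ->
    leb ((S `&` `[0, b]) `\` B) = 0 ->
    c1 <= b -> cum B c1 <= c1 / 2 -> 0 < x <= c1 ->
  cum A x <= x ^+ 2 / c1.
Proof.
move=> mA mB mS AS A_ge0 A0 H N c1b Bc1 /andP[x0 xc1].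
have c10 : 0 < c1 by lra.
rewrite leNgt; apply/negP => Fx.
pose Z := A `&` `[0, x].
have Z0 : Z 0 by split => //; rewrite /= in_itv/= lexx ltW.
have hZ : has_sup Z by split; [exists 0|exists x => t [_]; rewrite /= in_itv/= => /andP[]].
have Zub t : Z t -> t <= sup Z by move=> ?; apply: ub_le_sup => //; case: hZ.
set y := sup Z in Zub.
have y0 : 0 <= y by exact: Zub.
have yx : y <= x by apply: ge_sup; [exists 0|move=> t [_]; rewrite /= in_itv/= => /andP[]].
have Fy : cum A x = cum A y.
  congr leb; apply/seteqP; split => t /= [At]; rewrite !in_itv/= => /andP[? ?];
    split => //; last by lra.
  have := Zub t; rewrite /Z /= in_itv/= => h.
  by apply/andP; split => //; apply: h; split => //; lra.
have yy : y ^+ 2 <= x ^+ 2 by rewrite ler_sqr ?nnegrE; lra.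
have eta0 : 0 < cum A y - y ^+ 2 / c1.
  rewrite -Fy; suff : y ^+ 2 / c1 <= x ^+ 2 / c1 by lra.
  by rewrite ler_pM2r// invr_gt0.
have [z Zz yz] := sup_adherent eta0 hZ.
have zy := Zub _ Zz; rewrite -/y in yz.
have [Az] := Zz; rewrite /= in_itv/= => /andP[z0 zx].
have zz : z ^+ 2 / c1 <= y ^+ 2 / c1.
  by rewrite ler_pM2r ?invr_gt0// ler_sqr ?nnegrE; lra.
have := cum_lip mA zy => lip.
have Fz : z ^+ 2 / c1 < cum A z by lra.
have zpos : 0 < z.
  rewrite lt_neqAle z0 andbT; apply/eqP => zE; move: Fz.
  by rewrite -zE cum0// expr0n /= mul0r ltxx.
have zc : 0 < z <= c1 by lra.
by have := quadratic_mem mA mB mS AS A_ge0 H N c1b Bc1 zc Az; lra.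
Qed.

End quadratic_bound.

(** * Inner measure *)

Section inner_measure.
Variable R : realType.
Implicit Types A B S X Y K C E : set R.
Local Notation mu := (@lebesgue_measure R).

Lemma inner_measurable X : measurable X -> inner_lebesgue X = mu X.
Proof. by move=> mX; rewrite /inner_lebesgue -lebesgue_regularity_inner_sup. Qed.

Lemma le_inner X Y : X `<=` Y -> (inner_lebesgue X <= inner_lebesgue Y)%E.
Proof.
move=> XY; apply: ge_ereal_sup => _ [K [cK KX] <-].
by apply: ereal_sup_ubound; exists K => //; split => //; exact: subset_trans XY.
Qed.

Lemma inner_ge0 X : (0 <= inner_lebesgue X)%E.
Proof.
have <- : inner_lebesgue (set0 : set R) = 0%E by rewrite inner_measurable// measure0.
exact: le_inner.
Qed.

Lemma negligible_leb X : fm X -> leb X = 0 -> mu.-negligible X.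
Proof.
move=> fX X0; apply/negligibleP; first exact: fm_measurable.
by rewrite -[LHS]/(mu X) lebE// X0.
Qed.

Lemma leb_negligible X : measurable X -> mu.-negligible X -> leb X = 0.
Proof. by move=> mX /(negligibleP mu mX).1 X0; rewrite /leb [X in fine X]X0. Qed.

Lemma negligible_set1 (x : R) : mu.-negligible [set x].
Proof. by apply: negligible_leb; [exact: fm_set1|exact: leb_set1]. Qed.

Lemma negligible_reflect (e : R) X : mu.-negligible X -> mu.-negligible (refl e X).
Proof.
move=> [N [mN N0 XN]]; exists (refl e N); split.
- exact: measurable_reflect.
- by rewrite mu_reflect.
- by move=> t /XN.
Qed.

(** A measurable part of [X] carrying all of its inner measure. Phrased with null differences, it
    passes to intersections, separated unions and reflections. *)
Definition inner_kernel X K : Prop :=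
  [/\ fm K, K `<=` X & forall C, fm C -> C `<=` X -> mu.-negligible (C `\` K)].

Lemma kernel_inner X K : inner_kernel X K -> inner_lebesgue X = (leb K)%:E.
Proof.
move=> [fK KX H]; rewrite -lebE//; apply/eqP; rewrite eq_le; apply/andP; split.
  apply: ge_ereal_sup => _ [C [cC CX] <-].
  have fC : fm C.
    by split; [exact: compact_measurable|exact: compact_finite_measure].
  rewrite -[X in (X <= _)%E]/(mu C) !lebE// lee_fin; apply: leb_le_ae => //.
  apply: leb_negligible; last exact: H.
  by apply: fm_measurable; apply: fmD => //; exact: fm_measurable.
by rewrite -inner_measurable; [exact: le_inner|exact: fm_measurable].
Qed.

(** [C] joined to [K] is still a measurable part of [X], so its excess over [K] must be null. *)
Lemma kernelP X K : fm K -> K `<=` X -> (inner_lebesgue X <= (leb K)%:E)%E ->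
  inner_kernel X K.
Proof.
move=> fK KX XK; split => // C fC CX.
have mK := fm_measurable fK.
have fCK : fm (C `\` K) by exact: fmD.
apply: negligible_leb => //.
have : (inner_lebesgue (C `|` K) <= (leb K)%:E)%E.
  by apply: le_trans XK; apply: le_inner => t [/CX|/KX].
have fU := fmU fC fK.
rewrite inner_measurable; last exact: fm_measurable.
rewrite lebE// lee_fin; have := lebID fU mK.
have -> : (C `|` K) `&` K = K by rewrite setIC setKU.
have -> : (C `|` K) `\` K = C `\` K by rewrite setDUl setDv setU0.
by move=> -> h; apply/le_anti; rewrite leb_ge0 andbT; lra.
Qed.

Lemma kernel_fm X : fm X -> inner_kernel X X.
Proof.
move=> fX; split => // C _ CX; rewrite (_ : _ `\` _ = set0).
  exact: negligible_set0.
by apply/seteqP; split => t // [/CX].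
Qed.

Lemma kernelI X K E : measurable E -> inner_kernel X K -> inner_kernel (X `&` E) (K `&` E).
Proof.
move=> mE [fK KX H]; split; [exact: fmI|by move=> t [/KX]|move=> C fC CXE].
apply: negligibleS (H C fC _); last by move=> t /CXE[].
by move=> t [Ct nK]; split => // Kt; apply: nK; split => //; case: (CXE _ Ct).
Qed.

(** The separating [E] splits a measurable part of the union into measurable parts of [X] and of
    [Y]; without separation this can fail. *)
Lemma kernelU X Y KX KY E : measurable E -> X `<=` E -> Y `&` E = set0 ->
  inner_kernel X KX -> inner_kernel Y KY -> inner_kernel (X `|` Y) (KX `|` KY).
Proof.
move=> mE XE YE [fX sX HX] [fY sY HY].
split; [exact: fmU|by move=> t [/sX|/sY]; [left|right]|move=> C fC CXY].
have h1 : mu.-negligible ((C `&` E) `\` KX).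
  apply: HX; first exact: fmI.
  move=> t [/CXY[//|Yt] Et]; suff : set0 t by [].
  by rewrite -YE.
have h2 : mu.-negligible ((C `\` E) `\` KY).
  apply: HY; first exact: fmD.
  by move=> t [/CXY[Xt|//] nE]; case: nE; exact: XE.
apply: negligibleS (negligibleU h1 h2) => t [Ct nK].
have [Et|nEt] := pselect (E t); [left|right]; split => // h; apply: nK; by [left|right].
Qed.

Lemma kernel_reflect (e : R) X K : inner_kernel X K -> inner_kernel (refl e X) (refl e K).
Proof.
move=> [fK KX H]; split; [exact: fm_reflect|by move=> t /KX|move=> C fC CX].
have -> : C `\` refl e K = refl e (refl e C `\` K).
  by apply/seteqP; split => t; rewrite /refl /= ?subKr.
apply: negligible_reflect; apply: H; first exact: fm_reflect.
by move=> t /CX; rewrite /refl/= subKr.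
Qed.

(** A compact part of [X] avoiding [Y] lies in [KX] almost everywhere and misses [KY], so it is
    null. *)
Lemma sub_upto0_kernel X Y KX KY : inner_kernel X KX -> KY `<=` Y ->
  mu.-negligible (KX `\` KY) -> sub_upto0 X Y.
Proof.
move=> [fX sX HX] sY N; apply/eqP; rewrite eq_le inner_ge0 andbT.
apply: ge_ereal_sup => _ [C [cC CX] <-].
have fC : fm C.
  by split; [exact: compact_measurable|exact: compact_finite_measure].
have CX' : C `<=` X by move=> t /CX[].
have : mu.-negligible C.
  apply: negligibleS (negligibleU (HX C fC CX') N) => t Ct.
  have [Kt|nKt] := pselect (KX t); [right|left]; split => // /sY.
  by have [] := CX _ Ct.
by move=> /(negligibleP mu (fm_measurable fC)).1 C0; rewrite [X in (X <= _)%E]C0.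
Qed.

Lemma sub_upto0_sub X Y : X `<=` Y -> sub_upto0 X Y.
Proof.
move=> XY; rewrite /sub_upto0 (_ : _ `\` _ = set0) ?inner_measurable ?measure0//.
by apply/seteqP; split => t // [/XY].
Qed.

Lemma sub_upto0_setD X X' Y : X `\` Y `<=` X' -> sub_upto0 X' Y -> sub_upto0 X Y.
Proof.
move=> XX h; apply/eqP; rewrite eq_le inner_ge0 andbT -h; apply: le_inner.
by move=> t [Xt nY]; split => //; apply: XX.
Qed.

Lemma inner_translate (e : R) X :
  inner_lebesgue [set t | X (t + e)] = inner_lebesgue X.
Proof.
have h (e' : R) Y : (inner_lebesgue Y <= inner_lebesgue [set t | Y (t + e')%R])%E.
  apply: ge_ereal_sup => _ [C [cC CY] <-].
  have mC := compact_measurable cC.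
  rewrite -[X in (X <= _)%E]/(mu C) -(mu_translate e' mC).
  apply: ereal_sup_ubound; exists [set t | C (t + e')] => //; split; last by move=> t /CY.
  have -> : [set t | C (t + e')] = (fun t => t - e') @` C.
    apply/seteqP; split => t /=; first by exists (t + e') => //; rewrite addrK.
    by move=> [u Cu <-]; rewrite subrK.
  apply: continuous_compact => //; apply: continuous_subspaceT => t.
  by apply: cvgB; [exact: cvg_id|exact: cvg_cst].
apply/eqP; rewrite eq_le h andbT; apply: le_trans (h (- e) _) _.
by apply: le_inner => t /=; rewrite subrK.
Qed.

(** * Sigma-compact kernels and their sums *)

Definition sigma_compact X :=
  exists2 F : nat -> set R, (forall n, compact (F n)) & X = \bigcup_n F n.

Lemma sigma_compact_measurable X : sigma_compact X -> measurable X.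
Proof.
by move=> [F cF ->]; apply: bigcupT_measurable => n; exact: compact_measurable.
Qed.

Lemma sumset_measurable X Y : sigma_compact X -> sigma_compact Y ->
  measurable (sumset X Y).
Proof.
move=> [F cF ->] [G cG ->].
have -> : sumset (\bigcup_n F n) (\bigcup_n G n) =
    \bigcup_n \bigcup_m sumset (F n) (G m).
  apply/seteqP; split => t.
    move=> [x [n _ Fx]] [y [m _ Gy] <-]; exists n => //; exists m => //.
    by exists x => //; exists y.
  move=> [n _ [m _ [x Fx [y Gy <-]]]].
  by exists x; [exists n|exists y => //; exists m].
apply: bigcupT_measurable => n; apply: bigcupT_measurable => m.
apply: compact_measurable.
have -> : sumset (F n) (G m) = (fun z : R * R => z.1 + z.2) @` (F n `*` G m).
  apply/seteqP; split => t.
    by move=> [x Fx [y Gy <-]]; exists (x, y).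
  by move=> [[x y] [Fx Gy] <-]; exists x => //; exists y.
apply: continuous_compact; last exact: compact_setX.
by apply: continuous_subspaceT; exact: add_continuous.
Qed.

(** A union of compact sets whose measures tend to the inner measure, each enlarged by two points of
    [X] close to [p] and [q] so that the extremes survive. *)
Lemma sigma_kernel X (p q : R) : X `<=` `[p, q] ->
    (forall e : R, 0 < e -> exists2 t, X t & t < p + e) ->
    (forall e : R, 0 < e -> exists2 t, X t & q - e < t) ->
  exists K, [/\ sigma_compact K, inner_kernel X K,
    (forall e : R, 0 < e -> exists2 t, K t & t < p + e) &
    (forall e : R, 0 < e -> exists2 t, K t & q - e < t)].
Proof.
move=> Xpq Xp Xq.
pose iv (n : nat) : R := n.+1%:R^-1.
have inv0 n : 0 < iv n by rewrite invr_gt0 ltr0n.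
have iv_lt (e : R) : 0 < e -> exists n, iv n < e.
  move=> e0; exists (Num.truncn e^-1); rewrite /iv invf_plt ?posrE ?ltr0n//.
  exact: truncnS_gt.
have finX : inner_lebesgue X \is a fin_num.
  rewrite ge0_fin_numE ?inner_ge0//; apply: le_lt_trans (le_inner Xpq) _.
  rewrite inner_measurable//; exact: (fm_itv true false p q).2.
have ex n : exists C, [/\ compact C, C `<=` X &
    (inner_lebesgue X - (iv n)%:E < mu C)%E /\
    (exists2 t, C t & t < p + iv n) /\ (exists2 t, C t & q - iv n < t)].
  have /ereal_sup_gt[_ [C [cC CX] <-] hC] :
      (inner_lebesgue X - (iv n)%:E < inner_lebesgue X)%E.
    by rewrite lteBlDr// lteDl// lte_fin.
  have [t1 Xt1 ht1] := Xp _ (inv0 n); have [t2 Xt2 ht2] := Xq _ (inv0 n).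
  exists (C `|` [set t1] `|` [set t2]).
  have cU : compact (C `|` [set t1] `|` [set t2]).
    by do 2?[apply: compactU]; [|exact: compact_set1|exact: compact_set1].
  split => //; first by move=> t [[/CX|->]|->].
  split; last by split; [exists t1 => //; left; right|exists t2 => //; right].
  apply: lt_le_trans hC _; apply: le_measure; rewrite ?inE; try exact: compact_measurable.
  by move=> t Ct; left; left.
pose F n := projT1 (cid (ex n)).
have HF n := projT2 (cid (ex n)).
have cF n : compact (F n) by have [] := HF n.
pose K := \bigcup_n F n.
have sK : sigma_compact K by exists F.
have mK := sigma_compact_measurable sK.
have KX : K `<=` X by move=> t [n _ Ft]; have [_ h _] := HF n; exact: h.
have fK : fm K by apply: (fm_bounded mK); exact: subset_trans Xpq.
exists K; split => //.
- apply: kernelP => //; rewrite -lebE//.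
  apply/lee_addgt0Pr => e e0.
  have [n hn] := iv_lt _ e0.
  have [_ _ [h _]] := HF n; rewrite -/(F n) in h.
  have FK : (mu (F n) <= mu K)%E.
    apply: le_measure; rewrite ?inE//; [exact: compact_measurable|].
    by move=> t Ft; exists n.
  move: h; rewrite lteBlDr// => /ltW /le_trans; apply.
  by apply: leeD => //; rewrite lee_fin ltW.
- move=> e e0; have [n hn] := iv_lt _ e0.
  have [_ _ [_ [[t Ft ht] _]]] := HF n; exists t; [by exists n|lra].
- move=> e e0; have [n hn] := iv_lt _ e0.
  have [_ _ [_ [_ [t Ft ht]]]] := HF n; exists t; [by exists n|lra].
Qed.

(** [X + e + t] lies in [S] for arbitrarily small [t], so what [X + e] has outside [S] is bounded by
    the loss of [X] under a small translation. *)
Lemma translate_null X S (e : R) : fm X -> measurable S ->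
    (forall eps : R, 0 < eps -> exists2 t : R, `|t| < eps &
       forall u, X u -> S (u + (e + t))) ->
  mu.-negligible ([set u | X (u - e)] `\` S).
Proof.
move=> fX mS H.
have mX := fm_measurable fX.
have fXe : fm [set u | X (u - e)] by exact: fm_translate.
have fD : fm ([set u | X (u - e)] `\` S) by exact: fmD.
apply: negligible_leb => //; apply/le_anti; rewrite leb_ge0 andbT.
apply/ler_addgt0Pr => eps eps0; rewrite add0r.
have [eta eta0 He] := leb_translation_cts fX eps0.
have [t te Ht] := H _ eta0.
rewrite -normrN in te; apply: le_trans (ltW (He _ te)).
have fY : fm (X `\` [set u | X (u + - t)]).
  by apply: fmD => //; exact: measurable_translate.
rewrite -(leb_translate (- e) (fm_measurable fY)).
apply: le_leb; [exact: fm_measurable|exact: fm_translate|].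
move=> u [/= Xu nS]; split => //= Xu'; apply: nS.
by have := Ht _ Xu'; have -> : u - e - t + (e + t) = u by ring.
Qed.

End inner_measure.

(** * Reduction to measurable sets containing their endpoints *)

Section reduction.
Variable R : realType.
Implicit Types A B S X Y : set R.
Local Notation mu := (@lebesgue_measure R).

Lemma leb_eq_negligible X Y : measurable X -> fm Y -> X `<=` Y ->
  mu.-negligible (Y `\` X) -> leb X = leb Y.
Proof.
move=> mX fY XY N; rewrite (lebID fY mX) (setIidr XY).
by rewrite (leb_negligible _ N) ?addr0//; apply: fm_measurable; exact: fmD.
Qed.

(* [A0], [B0], [S0] exhaust [A], [B], [A + B]; the completed sets [A1], [B1],
   [S1] contain in addition the endpoints missing from [A] and [B]. *)
Record completion A B (a d : R) A0 B0 S0 A1 B1 S1 : Prop := Completion {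
  cp_kA : inner_kernel A A0; cp_kB : inner_kernel B B0; cp_kS : inner_kernel (sumset A B) S0;
  cp_A : A0 `<=` A1; cp_B : B0 `<=` B1; cp_S : S0 `<=` S1;
  cp_nA : mu.-negligible (A1 `\` A0);
  cp_nB : mu.-negligible (B1 `\` B0);
  cp_nS : mu.-negligible (S1 `\` S0);
  cp_cfg : sum_config A1 B1 S1 a d }.

Lemma completion_exists A B (a d : R) :
    A `<=` `[0, a] -> B `<=` `[0, d] -> d <= a ->
    (forall e : R, 0 < e -> exists2 t, A t & t < 0 + e) ->
    (forall e : R, 0 < e -> exists2 t, A t & a - e < t) ->
    (forall e : R, 0 < e -> exists2 t, B t & t < 0 + e) ->
    (forall e : R, 0 < e -> exists2 t, B t & d - e < t) ->
    inner_lebesgue (sumset A B) = (a%:E + inner_lebesgue B)%E ->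
    (a%:E + inner_lebesgue B < inner_lebesgue A + 2%:E * inner_lebesgue B)%E ->
  exists A0 B0 S0 A1 B1 S1, completion A B a d A0 B0 S0 A1 B1 S1.
Proof.
move=> Aa Bd da Ainf Asup Binf Bsup Seq Slt.
have [A0 [sA kA A0inf A0sup]] := sigma_kernel Aa Ainf Asup.
have [B0 [sB kB B0inf B0sup]] := sigma_kernel Bd Binf Bsup.
have [fA A0A _] := kA; have [fB B0B _] := kB.
have A0a := subset_trans A0A Aa; have B0d := subset_trans B0B Bd.
have a0 : 0 <= a by have [t /Aa] := Ainf _ ltr01; rewrite /= in_itv/=; lra.
have d0 : 0 <= d by have [t /Bd] := Binf _ ltr01; rewrite /= in_itv/=; lra.
move: Seq Slt; rewrite (kernel_inner kA) (kernel_inner kB) => Seq.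
rewrite -EFinM -!EFinD lte_fin => Slt.
have mA := fm_measurable fA; have mB := fm_measurable fB.
have lA : leb A0 <= a.
  rewrite -[leRHS]subr0 -(leb_itv true false a0); apply: le_leb => //; exact: fm_itv.
have lB : leb B0 <= d.
  rewrite -[leRHS]subr0 -(leb_itv true false d0); apply: le_leb => //; exact: fm_itv.
pose S0 := sumset A0 B0.
have mS : measurable S0 by exact: sumset_measurable.
have S0S : S0 `<=` sumset A B.
  by move=> _ [x Ax [y By <-]]; exists x; [exact: A0A|exists y => //; exact: B0B].
have S0ad : S0 `<=` `[0, a + d].
  move=> _ [x /A0a + [y /B0d + <-]]; rewrite /= !in_itv/=; lra.
have fS := fm_bounded mS S0ad.
pose A1 := A0 `|` [set 0; a]; pose B1 := B0 `|` [set 0; d].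
have f2 (x y : R) : fm [set x; y] by apply: fmU; exact: fm_set1.
have n2 (x y : R) : mu.-negligible [set x; y].
  by apply: negligibleU; exact: negligible_set1.
have fA1 : fm A1 by exact: fmU.
have fB1 : fm B1 by exact: fmU.
have nA1 : mu.-negligible (A1 `\` A0).
  by apply: negligibleS (n2 0 a) => t [[]].
have nB1 : mu.-negligible (B1 `\` B0).
  by apply: negligibleS (n2 0 d) => t [[]].
have lA1 := leb_eq_negligible mA fA1 (@subsetUl _ _ _) nA1.
have lB1 := leb_eq_negligible mB fB1 (@subsetUl _ _ _) nB1.
(* The sums created by the new endpoints: [B0] moved by 0 and [a], [A0] moved by 0 and [d], and the
   four endpoint sums in [P]. *)
pose T1 := [set u | B0 (u - 0)]; pose T2 := [set u | B0 (u - a)].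
pose T3 := [set u | A0 (u - 0)]; pose T4 := [set u | A0 (u - d)].
pose P := [set 0; a] `|` [set d; a + d].
pose S1 := S0 `|` ((T1 `|` T2) `|` (T3 `|` T4)) `|` P.
have nT1 : mu.-negligible (T1 `\` S0).
  apply: translate_null => // e e0; have [t At te] := A0inf _ e0; exists t.
    by have := A0a _ At; rewrite /= in_itv/= ltr_norml => /andP[? ?]; apply/andP; split; lra.
  by move=> u Bu; exists t => //; exists u => //; ring.
have nT2 : mu.-negligible (T2 `\` S0).
  apply: translate_null => // e e0; have [t At te] := A0sup _ e0; exists (t - a).
    by have := A0a _ At; rewrite /= in_itv/= ltr_norml => /andP[? ?]; apply/andP; split; lra.
  by move=> u Bu; exists t => //; exists u => //; ring.
have nT3 : mu.-negligible (T3 `\` S0).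
  apply: translate_null => // e e0; have [t Bt te] := B0inf _ e0; exists t.
    by have := B0d _ Bt; rewrite /= in_itv/= ltr_norml => /andP[? ?]; apply/andP; split; lra.
  by move=> u Au; exists u => //; exists t => //; ring.
have nT4 : mu.-negligible (T4 `\` S0).
  apply: translate_null => // e e0; have [t Bt te] := B0sup _ e0; exists (t - d).
    by have := B0d _ Bt; rewrite /= in_itv/= ltr_norml => /andP[? ?]; apply/andP; split; lra.
  by move=> u Au; exists u => //; exists t => //; ring.
have fS1 : fm S1.
  apply: fmU; last exact: fmU.
  apply: fmU => //; apply: fmU; apply: fmU; exact: fm_translate.
have nS1 : mu.-negligible (S1 `\` S0).
  have nT := negligibleU (negligibleU nT1 nT2) (negligibleU nT3 nT4).
  apply: negligibleS (negligibleU nT (negligibleU (n2 0 a) (n2 d (a + d)))).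
  move=> t [[[//|h]|h] nS]; last by right.
  by left; case: h => [[h|h]|[h|h]]; [left; left|left; right|right; left|right; right].
have lS1 := leb_eq_negligible mS fS1 (fun t h => or_introl (or_introl h)) nS1.
have lS : (leb S0 <= a + leb B0)%R.
  by rewrite -lee_fin EFinD -Seq -lebE// -inner_measurable//; exact: le_inner.
have cfg : sum_config A1 B1 S1 a d.
  split; rewrite -?lA1 -?lB1 -?lS1//; try exact: fm_measurable.
  - by move=> t [/A0a//|[->|->]]; rewrite /= in_itv/= lexx a0.
  - by move=> t [/B0d//|[->|->]]; rewrite /= in_itv/= lexx d0.
  - move=> t [[/S0ad//|[[h|h]|[h|h]]]|h].
    + by have := B0d _ h; rewrite /= !in_itv/=; lra.
    + by have := B0d _ h; rewrite /= !in_itv/=; lra.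
    + by have := A0a _ h; rewrite /= !in_itv/=; lra.
    + by have := A0a _ h; rewrite /= !in_itv/=; lra.
    by case: h => -[->|->]; rewrite /= in_itv/=; lra.
  - by right; left.
  - by right; right.
  - by right; left.
  - by right; right.
  - move=> u v [Au|Au] [Bv|Bv].
    + by left; left; exists u => //; exists v.
    + left; right; right; case: Bv => ->; [left|right]; rewrite /T3 /T4 /=.
        by rewrite addr0 subr0.
      by rewrite addrK.
    + left; right; left; case: Au => ->; [left|right]; rewrite /T1 /T2 /=.
        by rewrite add0r subr0.
      by rewrite addrAC subrr add0r.
    + right; rewrite /P; case: Au => ->; case: Bv => ->; rewrite ?add0r ?addr0.
      * by left; left.
      * by right; left.
      * by left; right.
      * by right; right.
  - by lra.
  - by rewrite da andbT; lra.
(* Equality in the measure of [S1] shows that [S0] exhausts the inner measure of the sumset, so it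
   is a kernel. *)
have [_ lS'] := overlap_config cfg.
exists A0, B0, S0, A1, B1, S1; split => //.
- apply: kernelP => //; rewrite Seq -EFinD lee_fin lS1 lS' -lB1; exact: lexx.
- by move=> t ?; left.
- by move=> t ?; left.
- by move=> t ?; left; left.
Qed.

(** The half-density condition passes to the supremum [c1] by Lipschitz continuity, whence
    [c1 <= b], the range where [B] is stable. The restriction [x <= d] keeps the set bounded: every
    [x >= 2d] satisfies the inequality. *)
Lemma threshold_bound A B S (a d b c : R) :
    sum_config A B S a d -> critical A B S a d b c ->
    let c1 := sup [set x : R | 0 <= x <= d /\ cum B x <= x / 2] in
  forall x, 0 < x <= c1 -> cum A x <= x ^+ 2 / c1.
Proof.
move=> cfg cr; set E := [set x | _]; move=> c1 x xc1.
have mB := sc_mB cfg; have /andP[d0 da] := sc_d cfg.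
have E0 : E 0 by rewrite /E /= cum0// mul0r !lexx ltW.
have hE : has_sup E by split; [exists 0|exists d => t [/andP[]]].
have Eub t : E t -> t <= c1 by move=> ?; apply: ub_le_sup => //; case: hE.
have c10 := Eub _ E0.
have c1d : c1 <= d by apply: ge_sup; [exists 0|move=> t [/andP[]]].
have Bc1 : cum B c1 <= c1 / 2.
  rewrite leNgt; apply/negP => h.
  have h' : 0 < cum B c1 - c1 / 2 by lra.
  have [z Ez zc] := sup_adherent h' hE; rewrite -/c1 in zc.
  have [/andP[z0 zd] Bz] := Ez; have zc1 := Eub _ Ez.
  by have := cum_lip mB zc1; lra.
have c1b : c1 <= b by apply: (half_density_le cfg cr) => //; rewrite c10.
apply: (quadratic (sc_mA cfg) mB (sc_mS cfg) (sum_config_sub cfg) _ (sc_A0 cfg)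
  (sc_sum cfg) (le_null (cr_b cr)) c1b Bc1 xc1).
by move=> t /(sc_A cfg); rewrite /= in_itv/= => /andP[].
Qed.

Lemma refl_setE (e : R) X : refl_set e X = refl e X.
Proof.
apply/seteqP; split => t; first by move=> [x Xx <-]; rewrite /refl /= subKr.
by move=> Xt; exists (e - t) => //; rewrite subKr.
Qed.

(** * From the completed sets back to the kernels *)

Section structure.
Variables (A B : set R) (a d : R) (A0 B0 S0 A1 B1 S1 : set R) (b c : R).
Hypothesis cp : completion A B a d A0 B0 S0 A1 B1 S1.
Hypothesis cr : critical A1 B1 S1 a d b c.
Let cfg := cp_cfg cp.
Let mB0 : measurable B0. Proof. by have [/fm_measurable] := cp_kB cp. Qed.
Let mA0 : measurable A0. Proof. by have [/fm_measurable] := cp_kA cp. Qed.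

Lemma leb_cpA : leb A0 = leb A1.
Proof.
apply: leb_eq_negligible mA0 _ (cp_A cp) (cp_nA cp).
exact: fm_bounded (sc_mA cfg) (sc_A cfg).
Qed.

Lemma leb_cpB : leb B0 = leb B1.
Proof.
apply: leb_eq_negligible mB0 _ (cp_B cp) (cp_nB cp).
exact: fm_bounded (sc_mB cfg) (sc_B cfg).
Qed.

Lemma cum_cpB (x : R) : cum B0 x = cum B1 x.
Proof.
apply: leb_eq_negligible; [exact: measurableI|exact: fm_cum (sc_mB cfg)| |].
  by move=> t [/(cp_B cp)].
by apply: negligibleS (cp_nB cp) => t [[? ?] n]; split => // ?; apply: n.
Qed.

Lemma cum_cpB_refl (x : R) : leb (B0 `&` `]d - x, d[) = cum (refl d B1) x.
Proof.
have m0 : measurable (B0 `&` `]d - x, d[) by exact: measurableI.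
have m1 : measurable (refl d B1) := sc_mB (sum_config_refl cfg).
rewrite -(leb_reflect d m0); apply: leb_eq_negligible.
- exact: measurable_reflect.
- exact: fm_cum.
- by move=> t [/(cp_B cp) Bt]; rewrite /= !in_itv/= => ?; split => //; lra.
have n01 := negligibleU (negligible_set1 0) (negligible_set1 x).
apply: negligibleS (negligibleU (negligible_reflect d (cp_nB cp)) n01).
move=> t [[Bt]]; rewrite /= in_itv/= => /andP[t0 tx] n.
have [->|t0'] := eqVneq t 0; first by right; left.
have [->|tx'] := eqVneq t x; first by right; right.
left; split => // Bt0; apply: n; split => //.
have t0lt : 0 < t by rewrite lt_neqAle eq_sym t0'.
have txlt : t < x by rewrite lt_neqAle tx'.
by rewrite /= in_itv/=; lra.
Qed.

Lemma low_negl X :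
    X `<=` S1 -> X `<=` `[0, b] -> mu.-negligible (X `\` B0).
Proof.
move=> XS Xb.
have N : mu.-negligible ((S1 `&` `[0, b]) `\` B1).
  apply: negligible_leb (le_null (cr_b cr)).
  by apply: fmD (sc_mB cfg); exact: fm_cum (sc_mS cfg).
apply: negligibleS (negligibleU N (cp_nB cp)) => t [Xt nB].
have [Bt|nBt] := pselect (B1 t); [by right|left; split => //].
by split; [exact: XS|exact: Xb].
Qed.

(** The free parameter [e] covers two uses: [e = a + d] for the upper end of the sumset, [e = a] for
    that of [A]. *)
Lemma high_negl (e : R) X : refl e X `<=` refl (a + d) S1 -> X `<=` `[e - c, e] ->
  mu.-negligible (X `\` refl e (refl d (B0 `&` `[d - c, d]))).
Proof.
move=> XS Xc.
have N : mu.-negligible ((refl (a + d) S1 `&` `[0, c]) `\` refl d B1).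
  have cfg' := sum_config_refl cfg.
  apply: negligible_leb (le_null (cr_c cr)).
  by apply: fmD (sc_mB cfg'); exact: fm_cum (sc_mS cfg').
have := negligible_reflect e (negligibleU N (negligible_reflect d (cp_nB cp))).
apply: negligibleS => t [Xt nB].
have tc : 0 <= e - t <= c by have := Xc _ Xt; rewrite /= in_itv/=; lra.
have [Bt|nBt] := pselect (B1 (d - (e - t))); [right|left]; split => //.
  by move=> Bt'; apply: nB; split => //; rewrite /= in_itv/=; lra.
split; last by rewrite /= in_itv.
by apply: XS; rewrite /refl /= subKr.
Qed.

Lemma middle_negl : mu.-negligible (`]b, d - c[ `\` B0).
Proof.
have N : mu.-negligible (`]b, d - c[ `\` B1).
  by apply: negligible_leb (cr_I cr); apply: fmD (sc_mB cfg); exact: fm_itv.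
apply: negligibleS (negligibleU N (cp_nB cp)) => t [tI nB].
by have [Bt|nBt] := pselect (B1 t); [right|left].
Qed.

Lemma sum_negl X : X `<=` S1 -> mu.-negligible (X `\` S0).
Proof. by move=> XS; apply: negligibleS (cp_nS cp) => t [/XS]. Qed.

End structure.

End reduction.

(** * Normalisation by the infimum *)

Section shift.
Variable R : realType.
Implicit Types A B : set R.

Lemma shift_infE A : shift_inf A = [set t | A (t + inf A)].
Proof.
apply/seteqP; split => t; first by move=> [x Ax <-]; rewrite /= subrK.
by move=> At; exists (t + inf A) => //; rewrite addrK.
Qed.

Lemma sumset_shift_inf A B : sumset (shift_inf A) (shift_inf B) =
  [set t | sumset A B (t + (inf A + inf B))].
Proof.
apply/seteqP; split => t.
  move=> [_ [x Ax <-] [_ [y By <-] <-]]; exists x => //; exists y => //.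
  by ring.
move=> [x Ax [y By xy]]; exists (x - inf A); first by exists x.
exists (y - inf B); first by exists y.
by lra.
Qed.

Lemma bounded_has_sup A : bounded_set A -> A !=set0 -> has_sup A.
Proof.
move=> [M [_ HM]] A0; split => //; exists (M + 1) => x Ax.
have M1 : M < M + 1 by rewrite ltrDl ltr01.
by have : `|x| <= M + 1 := HM _ M1 _ Ax; rewrite ler_norml => /andP[].
Qed.

Lemma bounded_has_inf A : bounded_set A -> A !=set0 -> has_inf A.
Proof.
move=> [M [_ HM]] A0; split => //; exists (- (M + 1)) => x Ax.
have M1 : M < M + 1 by rewrite ltrDl ltr01.
by have : `|x| <= M + 1 := HM _ M1 _ Ax; rewrite ler_norml => /andP[].
Qed.

Lemma shift_inf_itv A : bounded_set A -> shift_inf A `<=` `[0, diam A].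
Proof.
move=> bA _ [x Ax <-]; have nA : A !=set0 by exists x.
have [_ hu] := bounded_has_sup bA nA; have [_ hl] := bounded_has_inf bA nA.
have := ub_le_sup hu Ax; have := ge_inf hl Ax.
by rewrite /diam /= in_itv/=; lra.
Qed.

Lemma shift_inf_low A : bounded_set A -> A !=set0 ->
  forall e : R, 0 < e -> exists2 t, shift_inf A t & t < 0 + e.
Proof.
move=> bA nA e e0; have [t At te] := inf_adherent e0 (bounded_has_inf bA nA).
by exists (t - inf A); [exists t|lra].
Qed.

Lemma shift_inf_high A : bounded_set A -> A !=set0 ->
  forall e : R, 0 < e -> exists2 t, shift_inf A t & diam A - e < t.
Proof.
move=> bA nA e e0; have [t At te] := sup_adherent e0 (bounded_has_sup bA nA).
by exists (t - inf A); [exists t|rewrite /diam; lra].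
Qed.

Lemma inner_shift_inf A : inner_lebesgue (shift_inf A) = inner_lebesgue A.
Proof. by rewrite shift_infE inner_translate. Qed.

Lemma inner_set0 : inner_lebesgue (set0 : set R) = 0%E.
Proof. by rewrite inner_measurable// measure0. Qed.

Lemma inner_le_diam A : bounded_set A -> A !=set0 ->
  (inner_lebesgue A <= (diam A)%:E)%E.
Proof.
move=> bA [x Ax]; rewrite -inner_shift_inf.
apply: le_trans (le_inner (shift_inf_itv bA)) _.
have d0 : 0 <= diam A.
  have : shift_inf A (x - inf A) by exists x.
  by move=> /(shift_inf_itv bA); rewrite /= in_itv/=; lra.
by rewrite inner_measurable// lebE ?leb_itv ?subr0//; exact: fm_itv.
Qed.

End shift.


Theorem theorem4p1 (R : realType) (A B : set R)
    (bndA : bounded_set A) (bndB : bounded_set B)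
    (le_diam : diam B <= diam A)
    (sum_eq : inner_lebesgue (sumset A B)
              = ((diam A)%:E + inner_lebesgue B)%E)
    (sum_lt : ((diam A)%:E + inner_lebesgue B
               < inner_lebesgue A + 2%:E * inner_lebesgue B)%E) :
  let DA := diam A in
  let DB := diam B in
  let A' := shift_inf A in
  let B' := shift_inf B in
  let S' := sumset A' B' in
  exists b c : R,
    (* non-strict: for A = B = [0, 1] the length bound forces b = c = 0 *)
    [/\ 0 <= b <= DB, 0 <= c <= DB,
        (inner_lebesgue A + inner_lebesgue B - DA%:E
           <= ((DB - c) - b)%:E)%E &
    let I : set R := `]b, DB - c[%classic in
    let J : set R := `]b, DA + DB - c[%classic in
    let B1 := B' `&` `[0, b] in
    let B2 := refl_set DB (B' `&` `[DB - c, DB]) in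
    [/\ eq_upto0 (B' `&` `[0, b]) (S' `&` `[0, b]),
        eq_upto0 (S' `&` `[DA + DB - c, DA + DB]) (refl_set (DA + DB) B2),
        sub_upto0 I B',
        sub_upto0 J S' &
        eq_upto0 B' (B1 `|` I `|` refl_set DB B2) /\
        eq_upto0 S' (B1 `|` J `|` refl_set (DA + DB) B2)] /\
    exists A1 AI A2 : set R,
      [/\ eq_upto0 A' (A1 `|` AI `|` refl_set DA A2),
          [/\ A1 `&` AI = set0, A1 `&` refl_set DA A2 = set0 &
              AI `&` refl_set DA A2 = set0],
          [/\ A1 `<=` B1, A2 `<=` B2 & AI `<=` `]b, DA - c[%classic],
          (let c1 := sup [set x : R | 0 <= x <= DB /\
             (inner_lebesgue (B' `&` `[0, x])%R <= (x / 2)%:E)%E] in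
           forall x : R, 0 < x <= c1 ->
             (inner_lebesgue (A1 `&` `[0, x])%R <= (x ^+ 2 / c1)%:E)%E) &
          (let c2 := sup [set x : R | 0 <= x <= DB /\
             (inner_lebesgue (B' `&` `]DB - x, DB[)%R <= (x / 2)%:E)%E] in
           forall x : R, 0 < x <= c2 ->
             (inner_lebesgue (A2 `&` `[0, x])%R <= (x ^+ 2 / c2)%:E)%E)]].
Proof.
move=> DA DB A' B' S'.
(* For empty [A], [sup] and [inf] default to 0, so the equation forces [B] to have inner measure 0
   and the strict inequality reads 0 < 0. *)
have nA : A !=set0.
  apply/set0P/negP => /eqP A0; move: sum_eq sum_lt.
  have -> : sumset A B = set0.
    by rewrite A0; apply/seteqP; split => t // [x].
  rewrite A0 /diam sup0 inf0 subrr inner_set0 !add0e => <-.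
  by rewrite mule0 ltxx.
(* For empty [B] the strict inequality would make the inner measure of [A] exceed its diameter. *)
have nB : B !=set0.
  apply/set0P/negP => /eqP B0; move: sum_lt.
  by rewrite B0 inner_set0 mule0 !adde0 ltNge inner_le_diam.
have SE : inner_lebesgue S' = (DA%:E + inner_lebesgue B')%E.
  by rewrite /S' sumset_shift_inf inner_translate sum_eq inner_shift_inf.
have SL : (DA%:E + inner_lebesgue B' < inner_lebesgue A' + 2%:E * inner_lebesgue B')%E.
  by rewrite !inner_shift_inf.
have A'a : A' `<=` `[0, DA] := shift_inf_itv bndA.
have B'd : B' `<=` `[0, DB] := shift_inf_itv bndB.
have [A0 [B0 [S0 [A1 [B1 [S1 cp]]]]]] := completion_exists A'a B'd le_diam
  (shift_inf_low bndA nA) (shift_inf_high bndA nA)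
  (shift_inf_low bndB nB) (shift_inf_high bndB nB) SE SL.
have cfg := cp_cfg cp; have cfg' := sum_config_refl cfg.
have [b [c cr]] := critical_exists cfg.
have cr' := critical_refl (sc_mA cfg) (sc_mB cfg) cr.
have [[kA kB] kS] := (cp_kA cp, cp_kB cp, cp_kS cp).
have [fA A0A _] := kA; have [fB B0B _] := kB; have [fS S0S _] := kS.
have b0 := le_b0 (cr_b cr); have c0 := le_b0 (cr_c cr).
have bc := cr_bc cr; have lt := sc_lt cfg; have /andP[d0 da] := sc_d cfg.
have B1S : B1 `<=` S1.
  by move=> t Bt; rewrite -[t]add0r; exact: (sc_sum cfg (sc_A0 cfg) Bt).
exists b, c; split; [by lra|by lra| |].
  rewrite -(inner_shift_inf A) -(inner_shift_inf B) (kernel_inner kA) (kernel_inner kB).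
  by rewrite -!EFinD lee_fin (leb_cpA cp) (leb_cpB cp).
move=> I J C1 C2.
have C2r : C2 = refl DB (B' `&` `[DB - c, DB]) by exact: refl_setE.
clearbody C2; subst C2; set C2 := refl DB _.
rewrite (refl_setE (DA + DB)) (refl_setE DB).
have C1K : inner_kernel C1 (B0 `&` `[0, b]) by exact: kernelI.
have C2E : refl DB C2 = B' `&` `[DB - c, DB] by exact: reflK.
(* The two reflections compose to the translation by [DA]; the result lies in [S1] because [DA]
   belongs to [A1]. *)
pose K2 := refl (DA + DB) (refl DB (B0 `&` `[DB - c, DB])).
have RK : inner_kernel (refl (DA + DB) C2) K2.
  by do 2!apply: kernel_reflect; exact: kernelI.
have K2sub : K2 `<=` refl (DA + DB) C2 by case: RK.
have K2S : K2 `<=` S1.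
  move=> t [/(cp_B cp) Bt _].
  by have := sc_sum cfg (sc_Aa cfg) Bt; have -> : DA + (DB - (DA + DB - t)) = t by ring.
have S0S1 := cp_S cp.
have nlow : (@lebesgue_measure R).-negligible ((S0 `&` `[0, b]) `\` B0).
  by apply: (low_negl cp cr) => t [/S0S1].
have nhigh : (@lebesgue_measure R).-negligible ((S0 `&` `[DA + DB - c, DA + DB]) `\` K2).
  by apply: (high_negl cp cr); [move=> t [/S0S1]|move=> t []].
have IB : sub_upto0 I B'.
  apply: (sub_upto0_kernel (kernel_fm (fm_itv _ _ _ _)) B0B).
  exact: (middle_negl cp cr).
have JS1 : J `<=` S1 := cr_J cr.
split.
  split => //.
  - split.
      apply: (@sub_upto0_kernel _ _ _ _ (S0 `&` `[0, b]) C1K); first by move=> t [/S0S].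
      apply: negligibleS (sum_negl cp B1S) => t [[Bt tb] n]; split; first exact: (cp_B cp).
      by move=> St; apply: n.
    apply: (@sub_upto0_kernel _ _ _ _ (B0 `&` `[0, b]) (kernelI _ kS)) => //.
      by move=> t [/B0B].
    by apply: negligibleS nlow => t [[St tb] n]; split => // Bt; apply: n.
  - split.
      exact: (sub_upto0_kernel (kernelI (measurable_itv _) kS) K2sub nhigh).
    apply: (@sub_upto0_kernel _ _ _ _ (S0 `&` `[DA + DB - c, DA + DB]) RK).
      by move=> t [/S0S].
    apply: negligibleS (sum_negl cp K2S) => t [Kt n]; split => // St; apply: n; split => //.
    by move: Kt => [_]; rewrite /= !in_itv/=; lra.
  - apply: (sub_upto0_kernel (kernel_fm (fm_itv _ _ _ _)) S0S).
    exact: (sum_negl cp JS1).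
  split.
    rewrite C2E; split.
      (* The three intervals cover [0, DB], so this inclusion is exact; conversely only [I] can
         leave [B']. *)
      apply: sub_upto0_sub => t Bt; have := B'd _ Bt; rewrite /= in_itv/= => /andP[t0 td].
      have [tb|bt] := leP t b.
        have tb' : `[0, b]%classic t by rewrite /= in_itv/= t0.
        by left; left.
      have [tc|ct] := ltP t (DB - c).
        have tI : I t by rewrite /I /= in_itv/= bt.
        by left; right.
      have tc' : `[DB - c, DB]%classic t by rewrite /= in_itv/= ct.
      by right.
    by apply: sub_upto0_setD IB => t [[[[//]|//]|[//]]].
  split.
    apply: (@sub_upto0_kernel _ _ _ _ ((B0 `&` `[0, b]) `|` J `|` K2) kS).
      by move=> t [[[/B0B]|]|/K2sub]; [left; left|left; right|right].
    apply: negligibleS (negligibleU nlow nhigh) => t [St n].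
    have := sc_S cfg (S0S1 _ St); rewrite /= in_itv/= => /andP[t0 tad].
    have [tb|bt] := leP t b.
      have tb' : `[0, b]%classic t by rewrite /= in_itv/= t0.
      by left; split => // Bt; apply: n; left; left.
    have [tc|ct] := ltP t (DA + DB - c).
      have tJ : J t by rewrite /J /= in_itv/= bt.
      by exfalso; apply: n; left; right.
    have tc' : `[DA + DB - c, DA + DB]%classic t by rewrite /= in_itv/= ct.
    by right; split => // Kt; apply: n; right.
  (* The three pieces occupy disjoint intervals, so their kernels combine. *)
  have k1 : inner_kernel (C1 `|` J) ((B0 `&` `[0, b]) `|` J).
    apply: (@kernelU _ _ _ _ _ `[0, b]) => //.
    - by move=> t [].
    - by apply/seteqP; split => t // []; rewrite /J /= !in_itv/=; lra.
    - exact: kernel_fm (fm_itv _ _ _ _).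
  have k2 : inner_kernel (C1 `|` J `|` refl (DA + DB) C2) ((B0 `&` `[0, b]) `|` J `|` K2).
    apply: (@kernelU _ _ _ _ _ `[0, DA + DB - c[) => //.
    - by move=> t [[_]|]; rewrite /J /= !in_itv/=; lra.
    - by apply/seteqP; split => t // [[_]]; rewrite /= !in_itv/=; lra.
  apply: (sub_upto0_kernel k2 S0S); apply: (sum_negl cp).
  by move=> t [[[/(cp_B cp)/B1S]|/JS1]|/K2S].
(* Intersecting the two end pieces with [C1] and [C2] makes the inclusions exact; the points of [A']
   thereby lost are null, as [A1] and its translate by [DB] lie in [S1]. *)
exists (A' `&` C1), (A' `&` `]b, DA - c[), (refl DA (A' `&` `[DA - c, DA]) `&` C2).
have E2 : refl_set DA (refl DA (A' `&` `[DA - c, DA]) `&` C2) =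
    A' `&` `[DA - c, DA] `&` refl DA C2.
  by rewrite refl_setE -[in RHS](reflK DA (A' `&` _)).
rewrite E2; split.
- split; last first.
    by apply: sub_upto0_sub => t [[[]|[]]|[[]]].
  pose Y := (A0 `&` (B0 `&` `[0, b])) `|` (A0 `&` `]b, DA - c[) `|`
    (A0 `&` `[DA - c, DA] `&` refl DA (refl DB (B0 `&` `[DB - c, DB]))).
  apply: (@sub_upto0_kernel _ _ _ _ Y kA).
    move=> t [[[/A0A At [/B0B Bt tb]]|[/A0A At tI]]|[[/A0A At tc] [/B0B Bt tc']]].
    + by left; left.
    + by left; right.
    + by right.
  have n1 : (@lebesgue_measure R).-negligible ((A0 `&` `[0, b]) `\` B0).
    by apply: (low_negl cp cr) => t [] // /(cp_A cp)/(sum_config_sub cfg).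
  have n2 : (@lebesgue_measure R).-negligible ((A0 `&` `[DA - c, DA]) `\`
      refl DA (refl DB (B0 `&` `[DB - c, DB]))).
    apply: (high_negl cp cr) => [t [/(cp_A cp) At _]|t []//].
    have := sc_sum cfg At (sc_Bd cfg).
    by rewrite /refl /=; have -> : DA - t + DB = DA + DB - t by ring.
  apply: negligibleS (negligibleU n1 n2) => t [At n].
  have := A'a _ (A0A _ At); rewrite /= in_itv/= => /andP[t0 ta].
  have [tb|bt] := leP t b.
    have tb' : `[0, b]%classic t by rewrite /= in_itv/= t0.
    by left; split => // Bt; apply: n; left; left.
  have [tc|ct] := ltP t (DA - c).
    have tI : `]b, DA - c[%classic t by rewrite /= in_itv/= bt.
    by exfalso; apply: n; left; right.
  have tc' : `[DA - c, DA]%classic t by rewrite /= in_itv/= ct.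
  by right; split => // Kt; apply: n; right.
- split; apply/seteqP; split => t //.
  + by move=> [[_ [_ +]] [_ +]]; rewrite /= !in_itv/=; lra.
  + by move=> [[_ [_ +]] [[_ +] _]]; rewrite /= !in_itv/=; lra.
  + by move=> [[_ +] [[_ +] _]]; rewrite /= !in_itv/=; lra.
- by split => t [].
- have cE : [set x : R | 0 <= x <= DB /\
      (inner_lebesgue (B' `&` `[0, x])%R <= (x / 2)%:E)%E] =
    [set x : R | 0 <= x <= DB /\ cum B1 x <= x / 2].
    apply/seteqP; split => x [x0];
    by rewrite /= (kernel_inner (kernelI (measurable_itv _) kB)) -/(cum B0 x)
      lee_fin (cum_cpB cp).
  rewrite cE => c1 x xc1.
  have := threshold_bound cfg cr xc1; rewrite -lee_fin; apply: le_trans.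
  apply: (@le_trans _ _ (inner_lebesgue (A' `&` `[0, x]))).
    by apply: le_inner => t [[]].
  rewrite (kernel_inner (kernelI (measurable_itv _) kA)) lee_fin.
  apply: le_leb; [by apply: fm_measurable; exact: fmI|exact: fm_cum (sc_mA cfg)|].
  by move=> t [/(cp_A cp)].
(* The second bound is the first one for the reflected sets, with [b] and [c] exchanged. *)
- have cE : [set x : R | 0 <= x <= DB /\
      (inner_lebesgue (B' `&` `]DB - x, DB[)%R <= (x / 2)%:E)%E] =
    [set x : R | 0 <= x <= DB /\ cum (refl DB B1) x <= x / 2].
    apply/seteqP; split => x [x0];
    by rewrite /= (kernel_inner (kernelI (measurable_itv _) kB)) lee_fin (cum_cpB_refl cp).
  rewrite cE => c2 x xc2.
  have := threshold_bound cfg' cr' xc2; rewrite -lee_fin; apply: le_trans.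
  apply: (@le_trans _ _ (inner_lebesgue (refl DA A' `&` `[0, x]))).
    by apply: le_inner => t [[[]]].
  rewrite (kernel_inner (kernelI (measurable_itv _) (kernel_reflect DA kA))) lee_fin.
  have m1 := sc_mA cfg'.
  apply: le_leb; [|exact: fm_cum|by move=> t [/(cp_A cp)]].
  by apply: measurableI => //; apply: measurable_reflect; exact: fm_measurable.
Qed.
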